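(* For every $a\in\mathbb{R}$ and $b\in\mathbb{R}\setminus\{0\}$, $$\mathbb{P}\big(S(t)\le a+bt\ \text{for all } t\in[0,1]\big)=\Phi(a+b)\Phi(a)-\frac{1}{b}\phi(a)\Phi(a+b)+\frac{\sqrt{2\pi}}{b}\,\phi(a)\phi(b)\Phi(a)\,e^{-ab}.$$
   Context: $S(t)=B(t+1)-B(t)$, $t\in[0,1]$, where $B$ is a standard Brownian motion (the Slepian process). $\phi(x)=\frac{1}{\sqrt{2\pi}}e^{-x^2/2}$ is the standard normal density and $\Phi(x)=\int_{-\infty}^x\phi(s)\,ds$ the standard normal distribution function. *)

(* Defs.v *)
From HB Require Import structures.
From mathcomp Require Import all_boot all_order all_algebra.
From mathcomp Require Import all_classical all_reals all_analysis.
Set Implicit Arguments. Unset Strict Implicit. Unset Printing Implicit Defensive.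
Import Order.TTheory GRing.Theory Num.Theory.
Import numFieldNormedType.Exports.
Local Open Scope classical_set_scope.
Local Open Scope ring_scope.

Definition std_phi {R : realType} (x : R) : R :=
  (Num.sqrt (pi *+ 2))^-1 * expR (- (x ^+ 2) / 2).

Definition std_Phi {R : realType} (x : R) : R :=
  fine (\int[@lebesgue_measure R]_(s in `]-oo, x]) (std_phi s)%:E)%E.

(* B is a standard Brownian motion (indexed by t >= 0) on the probability
   space (T, P): B_0 = 0, continuous paths on [0, +oo), each B_t is a random
   variable, and for every finite grid 0 = t_0 < t_1 < ... < t_n the increments
   B_{t_{i+1}} - B_{t_i} are independent N(0, t_{i+1} - t_i)
   (normal_prob m s has mean m and standard deviation s). *)
Definition is_std_brownian {R : realType} {d : measure_display}
    {T : measurableType d} (P : probability T R) (B : R -> T -> R) : Prop :=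
  [/\ (forall w, B 0 w = 0),
      (forall w, {within `[0, +oo[, continuous (fun t => B t w)}),
      (forall t, 0 <= t -> measurable_fun setT (B t)) &
      (forall (n : nat) (ts : nat -> R) (A : nat -> set R),
          ts 0%N = 0 -> (forall i, (i < n)%N -> ts i < ts i.+1) ->
          (forall i, measurable (A i)) ->
          P [set w | forall i, (i < n)%N -> A i (B (ts i.+1) w - B (ts i) w)]
          = (\prod_(i < n) fine (normal_prob 0 (Num.sqrt (ts i.+1 - ts i)) (A i)))%:E)].

Definition slepian {R : realType} {T : Type} (B : R -> T -> R) (t : R) (w : T) : R :=
  B (t + 1) w - B t w.

(* Main.v *)
Require Import Defs.
From HB Require Import structures.
From mathcomp Require Import all_boot all_order all_algebra.
From mathcomp Require Import all_classical all_reals all_analysis.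
From mathcomp Require Import measurable_realfun ring lra.
Import Order.TTheory GRing.Theory Num.Theory.
Import numFieldNormedType.Exports.
Local Open Scope classical_set_scope.
Local Open Scope ring_scope.

(** Put [xi i] and [eta i] for the increments of [B] over [i/N, (i+1)/N] and
    [1+i/N, 1+(i+1)/N].  The differences [eta i - xi i] are the increments of
    [S] on the grid of mesh [1/N], and they are independent of the sums
    [eta i + xi i], whose total is [S 0 + S 1 = B 2].  So, on the grid, [S] is
    a random walk with steps [N(0, 2/N)] whose starting point, given the
    increments, has a Gaussian law read off from [S 0 + S 1].  The event that
    the walk stays below the line on the grid is compared with the method of
    images for the heat equation: for [k = exp (- b (a - x))], the function
    [p_2t(z - x) - k p_2t(z - 2a + x)] solves the heat equation and vanishes
    exactly on [z = a + b t], so it bounds the density of the killed walk from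
    below; with the line raised by [e] it bounds it from above up to
    [N] times the probability of jumping over a gap [e/2] in one step, which
    is super-exponentially small.  Integrating over the end points, letting
    [N = 2^m] tend to infinity and then [e] to 0, path continuity concludes. *)

(** * Lebesgue measure and Gaussian densities *)

(** The Slepian process is not Markov, so it cannot be killed at the line directly. Subtracting the
    start removes this obstacle: [S t - S 0] has independent increments and is independent of
    [S 0 + S 1]. Writing [S 0] as half of that sum minus the total displacement trades the random
    start for a weight [2 * gauss (1 *+ 2) (x + y)] that depends only on the end points [x] and [y],
    so the killed walk need only be tested against functions of its end point.

    A discrete walk jumps over the line, hence the image formula is not exact on a grid. Two
    inequalities, proved by induction on the number of steps, replace it; no stopping time and no
    reflection in continuous time is involved. They are asymmetric: the lower one holds on each grid
    without error, only the upper one needs the raised line.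

    The identity [gauss_rot] serves twice: it makes differences and sums independent, and it factors
    the weight times the transition density into [phi x * phi y], or [phi a * phi (y - (a - x))] for
    the image, which is why only [Phi], [phi] and exponentials survive. *)

Section Affine.
Context {R : realType}.
Notation mu := (@lebesgue_measure R).
Local Open Scope ereal_scope.

(** By uniqueness of Lebesgue measure: the right-hand side is a scaled pushforward, so only
    half-open intervals have to be computed. *)
Lemma lebesgue_measure_affine (r c : R) (A : set R) : (0 < r)%R ->
  measurable A ->
  lebesgue_measure A =
  (r%:E * lebesgue_measure ((fun x : R => r * x + c)%R @^-1` A)).
Proof.
move=> r0 mA.
have mphi : measurable_fun setT (fun x : measurableTypeR R => r * x + c : measurableTypeR R)%R.
  by apply: measurable_funD => //; exact: measurable_funM.
pose r' : {nonneg R} := NngNum (ltW r0).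
have := @lebesgue_measure_unique R
  (mscale r' (pushforward mu (fun x : measurableTypeR R => r * x + c : measurableTypeR R)%R)).
move=> /(_ mphi) H; apply: H => // _ [[x y]] _ <-.
rewrite /mscale/= /pushforward.
have E : (fun x0 : R => r * x0 + c)%R @^-1` [set` `]x, y]] = [set` `]((x - c) / r)%R, ((y - c) / r)%R]].
  apply/seteqP; split => z /=; rewrite !in_itv/= => /andP[h1 h2]; apply/andP; split.
  - by rewrite ltr_pdivrMr// mulrC ltrBlDr.
  - by rewrite ler_pdivlMr// mulrC lerBrDr.
  - by move: h1; rewrite ltr_pdivrMr// mulrC ltrBlDr.
  - by move: h2; rewrite ler_pdivlMr// mulrC lerBrDr.
transitivity (r%:E * mu [set` `]((x - c) / r)%R, ((y - c) / r)%R]]); last by rewrite -E.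
rewrite !lebesgue_measure_itv/= !lte_fin ltr_pM2r ?invr_gt0// ltrD2r.
case: ifP => _; last by rewrite mule0.
rewrite -!EFinB -EFinM; congr EFin.
by field; rewrite gt_eqF.
Qed.

Lemma ge0_integral_affine (r c : R) (f : R -> \bar R) : (0 < r)%R ->
  measurable_fun setT f -> (forall x, 0 <= f x) ->
  \int[mu]_x f x = r%:E * \int[mu]_x f (r * x + c)%R.
Proof.
move=> r0 mf f0.
pose phi := (fun x : measurableTypeR R => r * x + c : measurableTypeR R)%R.
have mphi : measurable_fun setT phi.
  by apply: measurable_funD => //; exact: measurable_funM.
pose r' : {nonneg R} := NngNum (ltW r0).
have -> : \int[mu]_x f (r * x + c)%R = \int[pushforward mu phi]_x f x.
  by rewrite (ge0_integral_pushforward mphi).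
rewrite -(ge0_integral_mscale _ _ r')//.
apply: eq_measure_integral => A mA _.
exact: lebesgue_measure_affine.
Qed.

Lemma ge0_integral_shift (c : R) (f : R -> \bar R) :
  measurable_fun setT f -> (forall x, 0 <= f x) ->
  \int[mu]_x f x = \int[mu]_x f (x + c)%R.
Proof.
move=> mf f0; rewrite (ge0_integral_affine 1 c)// mul1e.
by apply: eq_integral => x _; rewrite mul1r.
Qed.

End Affine.

(** Indexed by the variance, so that convolution adds indices. *)
Definition gauss {R : realType} (v x : R) : R := normal_pdf 0 (Num.sqrt v) x.

Section Gauss.
Context {R : realType}.
Notation mu := (@lebesgue_measure R).
Implicit Types v x y : R.

Lemma gaussE v x : 0 < v ->
  gauss v x = (Num.sqrt (v * pi *+ 2))^-1 * expR (- (x ^+ 2) / (v *+ 2)).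
Proof.
move=> v0; rewrite /gauss normal_pdfE ?gt_eqF ?sqrtr_gt0//.
by rewrite /normal_peak /normal_fun subr0 sqr_sqrtr ?ltW.
Qed.

Lemma gauss_ge0 v x : 0 <= gauss v x.
Proof. exact: normal_pdf_ge0. Qed.

Lemma measurable_gauss v : measurable_fun setT (gauss v).
Proof. exact: measurable_normal_pdf. Qed.

Lemma integral_gauss v : (\int[mu]_x (gauss v x)%:E = 1)%E.
Proof. exact: integral_normal_pdf. Qed.

Lemma gauss_opp v x : 0 < v -> gauss v (- x) = gauss v x.
Proof. by move=> v0; rewrite !gaussE// sqrrN. Qed.

Lemma gauss1 x : gauss 1 x = std_phi x.
Proof. by rewrite gaussE// /std_phi mul1r. Qed.

Lemma le_gauss v x y : 0 < v -> 0 <= x -> x <= y -> gauss v y <= gauss v x.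
Proof.
move=> v0 x0 xy; rewrite !gaussE// ler_wpM2l ?invr_ge0 ?sqrtr_ge0// ler_expR.
rewrite !mulNr lerN2 ler_pM2r ?invr_gt0 ?pmulrn_lgt0//.
by rewrite ler_sqr ?nnegrE// (le_trans x0).
Qed.

(* Completing the square in [x], with [x + y] fixed. *)
Lemma gauss_mul s r x y : 0 < s -> 0 < r ->
  gauss s x * gauss r y =
  gauss (s + r) (x + y) * gauss (s * r / (s + r)) (x - s * (x + y) / (s + r)).
Proof.
move=> s0 r0.
have sr0 : 0 < s + r by rewrite addr_gt0.
have q0 : 0 < s * r / (s + r) by rewrite divr_gt0// mulr_gt0.
have pi0 := pi_gt0 R.
rewrite !gaussE// mulrACA [RHS]mulrACA -!expRD -!invfM -!sqrtrM; last 2 first.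
  by rewrite mulrn_wge0// mulr_ge0// ltW.
  by rewrite mulrn_wge0// mulr_ge0// ltW.
congr ((Num.sqrt _)^-1 * expR _).
  by field; rewrite gt_eqF.
field.
by rewrite !gt_eqF.
Qed.

(** After completing the square, one factor is free of [z] and the other is a shifted density of
    mass 1. *)
Lemma gauss_conv s r w : 0 < s -> 0 < r ->
  (\int[mu]_z ((gauss s z)%:E * (gauss r (w - z))%:E) = (gauss (s + r) w)%:E)%E.
Proof.
move=> s0 r0.
transitivity (\int[mu]_z ((gauss (s + r) w)%:E * (gauss (s * r / (s + r)) (z - s * w / (s + r)))%:E))%E.
  by apply: eq_integral => z _; rewrite -!EFinM gauss_mul// [z + _]addrC subrK.
rewrite ge0_integralZl//; last 3 first.
- apply/measurable_EFinP; apply: measurableT_comp; first exact: measurable_gauss.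
  exact: measurable_funB.
- by move=> z _; rewrite lee_fin gauss_ge0.
- by rewrite lee_fin gauss_ge0.
rewrite -(@ge0_integral_shift _ (- (s * w / (s + r))) (fun z => (gauss (s * r / (s + r)) z)%:E)).
- by rewrite integral_gauss mule1.
- by apply/measurable_EFinP; exact: measurable_gauss.
- by move=> z; rewrite lee_fin gauss_ge0.
Qed.

End Gauss.

(** * Independence *)

Section Independence.
Context {R : realType}.
Notation mu := (@lebesgue_measure R).
Local Open Scope ereal_scope.

(** Change of variables holds for the Radon-Nikodym derivative, which agrees almost everywhere with
    the explicit density because both have the same integral over every measurable set. *)
Lemma ge0_integral_normal_prob (m s : R) (f : R -> \bar R) :
  measurable_fun setT f -> (forall x, 0 <= f x) ->
  \int[normal_prob m s]_x f x = \int[mu]_x (f x * (normal_pdf m s x)%:E).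
Proof.
move=> mf f0.
have dom := @normal_prob_dominates R m s.
rewrite -(Radon_Nikodym_SigmaFinite.change_of_variables dom)//.
have mpdf : measurable_fun setT (fun x => (normal_pdf m s x)%:E).
  by apply/measurable_EFinP; exact: measurable_normal_pdf.
have mrn : measurable_fun setT (Radon_Nikodym_SigmaFinite.f (normal_prob m s) mu).
  exact: measurable_int (Radon_Nikodym_SigmaFinite.f_integrable dom).
have ae : ae_eq mu setT (Radon_Nikodym_SigmaFinite.f (normal_prob m s) mu)
                        (fun x => (normal_pdf m s x)%:E).
  apply: integral_ae_eq => //.
  - exact: Radon_Nikodym_SigmaFinite.f_integrable dom.
  - by move=> E _ mE; rewrite -Radon_Nikodym_SigmaFinite.f_integral.
apply: ge0_ae_eq_integral => //.
- exact: emeasurable_funM.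
- exact: emeasurable_funM.
- by move=> x _; rewrite mule_ge0// Radon_Nikodym_SigmaFinite.f_ge0.
- by move=> x _; rewrite mule_ge0// lee_fin normal_pdf_ge0.
- exact: ae_eqe_mul2l.
Qed.

(** Rectangles are stable under intersection and generate the product sigma-algebra. *)
Lemma measure_rect_unique d1 d2 (E1 : measurableType d1) (E2 : measurableType d2)
    (m1 m2 : {measure set (E1 * E2) -> \bar R}) :
  (forall A C, measurable A -> measurable C -> m1 (A `*` C) = m2 (A `*` C)) ->
  m1 setT < +oo -> forall Z, measurable Z -> m1 Z = m2 Z.
Proof.
move=> m12 m1oo Z mZ.
pose G : set (set (E1 * E2)) :=
  [set C | exists A, measurable A /\ exists B, measurable B /\ C = A `*` B].
apply: (measure_unique G (fun=> setT)) => //.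
- rewrite measurable_prod_measurableType //; congr (<<s _ >>).
  rewrite predeqE; split => [[A mA [B mB <-]]|[A [mA [B [mB ->]]]]].
    by exists A; split => //; exists B.
  by exists A => //; exists B.
- move=> /= _ _ [X1 [mX1 [X2 [mX2 ->]]]] [Y1 [mY1 [Y2 [mY2 ->]]]].
  rewrite -setXI; exists (X1 `&` Y1); split; first exact: measurableI.
  by exists (X2 `&` Y2); split => //; exact: measurableI.
- by move=> _; exists setT; split => //; exists setT; rewrite setXTT.
- by apply/seteqP; split => // x _; exists 0%N.
- by move=> _ [A [mA [B [mB ->]]]]; exact: m12.
Qed.

Context d (T : measurableType d) (P : probability T R).

(** As functions of [Z], both sides are finite measures: the image of [P] restricted to [E], and a
    multiple of the image of [P]. [X] and [Y] may depend on each other; only the pair is independent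
    of [E]. *)
Lemma independent_pair d1 d2 (E1 : measurableType d1) (E2 : measurableType d2)
    (X : T -> E1) (Y : T -> E2) (E : set T) :
  measurable_fun setT X -> measurable_fun setT Y -> measurable E ->
  (forall A C, measurable A -> measurable C ->
    P (X @^-1` A `&` Y @^-1` C `&` E) = P (X @^-1` A `&` Y @^-1` C) * P E) ->
  forall Z, measurable Z ->
    P ((fun w => (X w, Y w)) @^-1` Z `&` E) =
    P ((fun w => (X w, Y w)) @^-1` Z) * P E.
Proof.
move=> mX mY mE H Z mZ.
pose XY w := (X w, Y w).
have mXY : measurable_fun setT XY by exact: measurable_fun_pair.
have PE0 : (0 <= fine (P E))%R by rewrite fine_ge0.
pose r : {nonneg R} := NngNum PE0.
have PE : P E = r%:num%:E by rewrite /= fineK// fin_num_measure.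
have := @measure_rect_unique _ _ _ _ (pushforward (mrestr P mE) XY)
  (mscale r (pushforward P XY)).
move=> /(_ mXY mXY) Q.
rewrite PE muleC; apply: (Q _ _ _ mZ).
- move=> A C mA mC; have := H _ _ mA mC.
  by rewrite /mscale /pushforward /mrestr PE [in RHS]muleC.
- rewrite /= /pushforward preimage_setT /mrestr setTI.
  by rewrite (le_lt_trans (probability_le1 P mE))// ltry.
Qed.

(** The joint law of [X] and [Y] is the product of their laws, so Tonelli integrates [Y] out with
    [X] frozen. *)
Lemma independent_integral d1 (E1 : measurableType d1) (X : T -> E1)
    (Y : T -> measurableTypeR R) (v : R) (f : E1 -> measurableTypeR R -> \bar R) :
  measurable_fun setT X -> measurable_fun setT Y ->
  (forall A C, measurable A -> measurable C ->
    P (X @^-1` A `&` Y @^-1` C) = P (X @^-1` A) * normal_prob 0 (Num.sqrt v) C) ->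
  measurable_fun setT (fun z => f z.1 z.2) -> (forall x y, 0 <= f x y) ->
  \int[P]_w f (X w) (Y w) =
  \int[P]_w \int[mu]_y (f (X w) y * (gauss v y)%:E).
Proof.
move=> mX mY H mf f0.
pose XY w := (X w, Y w).
have mXY : measurable_fun setT XY by exact: measurable_fun_pair.
pose X' : {RV P >-> E1} := HB.pack X (isMeasurableFun.Build _ _ _ _ _ mX).
pose Q := distribution P X'.
have E : forall Z, measurable Z ->
    (Q \x normal_prob 0 (Num.sqrt v)) Z = pushforward P XY Z.
  have := @product_measure_unique _ _ _ _ _ Q (normal_prob 0 (Num.sqrt v)) (pushforward P XY).
  move=> /(_ mXY) h; apply: h => A C mA mC.
  by rewrite /pushforward -H.
transitivity (\int[pushforward P XY]_z f z.1 z.2).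
  by rewrite ge0_integral_pushforward.
transitivity (\int[Q \x normal_prob 0 (Num.sqrt v)]_z f z.1 z.2).
  by apply: eq_measure_integral => Z mZ _; first [exact: E | exact/esym/E].
rewrite fubini_tonelli1// /fubini_F /=.
transitivity (\int[Q]_x \int[mu]_y (f x y * (gauss v y)%:E)).
  apply: eq_integral => x _; rewrite ge0_integral_normal_prob//.
  exact: (measurableT_comp mf (pair1_measurable x)).
rewrite ge0_integral_pushforward//.
- have := @measurable_fun_fubini_tonelli_F _ _ _ _ R (normal_prob 0 (Num.sqrt v))
    (fun z => f z.1 z.2) mf (fun z => f0 _ _).
  apply: eq_measurable_fun => x _; rewrite /fubini_F/= ge0_integral_normal_prob//.
  exact: (measurableT_comp mf (pair1_measurable x)).
- by move=> x _; apply: integral_ge0 => y _; rewrite mule_ge0// lee_fin gauss_ge0.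
Qed.

Lemma integral_normal_rv (X : T -> measurableTypeR R) (v : R)
    (f : measurableTypeR R -> \bar R) :
  measurable_fun setT X ->
  (forall A, measurable A -> P (X @^-1` A) = normal_prob 0 (Num.sqrt v) A) ->
  measurable_fun setT f -> (forall x, 0 <= f x) ->
  \int[P]_w f (X w) = \int[mu]_y (f y * (gauss v y)%:E).
Proof.
move=> mX H mf f0.
transitivity (\int[pushforward P X]_z f z).
  by rewrite ge0_integral_pushforward.
rewrite -ge0_integral_normal_prob//.
by apply: eq_measure_integral => Z mZ _; first [exact: H|exact/esym/H].
Qed.

Lemma integral_indic_gauss (v : R) (A : set R) : measurable A ->
  \int[mu]_x (\1_A x * gauss v x)%:E = normal_prob 0 (Num.sqrt v) A.
Proof.
move=> mA; rewrite /normal_prob [RHS]integral_mkcond epatch_indic.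
by apply: eq_integral => x _; rewrite muleC -EFinM.
Qed.

End Independence.

#[global] Opaque gauss.

(** A real number rather than the indicator of a set: the constraints compare varying quantities and
    are multiplied with densities. *)
Definition ind_le0 {R : realType} (t : R) : R := (t <= 0)%R%:R.

Lemma ind_le0_ge0 {R : realType} (t : R) : 0 <= ind_le0 t.
Proof. by rewrite /ind_le0 ler0n. Qed.

#[local] Hint Resolve ind_le0_ge0 : core.

(** * Measurability of explicit expressions *)

Section MeasurableLambda.
Context d (T : measurableType d) (R : realType) (D : set T).
Implicit Types (f g : T -> R) (h k : T -> \bar R).

Lemma measurable_lamM f g : measurable_fun D f -> measurable_fun D g ->
  measurable_fun D (fun x => f x * g x).
Proof. exact: measurable_funM. Qed.

Lemma measurable_lamD f g : measurable_fun D f -> measurable_fun D g ->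
  measurable_fun D (fun x => f x + g x).
Proof. exact: measurable_funD. Qed.

Lemma measurable_lamN f : measurable_fun D f ->
  measurable_fun D (fun x => - f x).
Proof. by move=> mf; exact: (measurableT_comp (@oppr_measurable R setT) mf). Qed.

Lemma measurable_lamE f : measurable_fun D f ->
  measurable_fun D (fun x => (f x)%:E).
Proof. by move=> mf; exact/measurable_EFinP. Qed.

Lemma measurable_lame h k : measurable_fun D h -> measurable_fun D k ->
  measurable_fun D (fun x => h x * k x)%E.
Proof. exact: emeasurable_funM. Qed.

Lemma measurable_lam_gauss v f : measurable_fun D f ->
  measurable_fun D (fun x => gauss v (f x)).
Proof. by move=> mf; exact: (measurableT_comp (measurable_gauss v) mf). Qed.

Lemma measurable_lam_expR f : measurable_fun D f ->
  measurable_fun D (fun x => expR (f x)).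
Proof. by move=> mf; exact: (measurableT_comp (@measurable_expR R) mf). Qed.

Lemma measurable_lam_indic (A : set R) f : measurable A -> measurable_fun D f ->
  measurable_fun D (fun x => \1_A (f x) : R).
Proof. by move=> mA mf; apply: (measurableT_comp _ mf); exact: measurable_indic. Qed.

Lemma measurable_lam_ind_le0 f : measurable_fun D f ->
  measurable_fun D (fun x => ind_le0 (f x)).
Proof.
move=> mf; apply: (measurableT_comp _ mf).
rewrite (_ : ind_le0 = \1_[set` `]-oo, 0%R]]); first exact: measurable_indic.
by apply/funext => t; rewrite indicE /ind_le0 mem_setE in_itv.
Qed.

Lemma measurable_lamade h k : measurable_fun D h -> measurable_fun D k ->
  measurable_fun D (fun x => h x + k x)%E.
Proof. exact: emeasurable_funD. Qed.

End MeasurableLambda.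

Lemma measurable_lam_app d1 d2 d3 (T1 : measurableType d1)
    (T2 : measurableType d2) (T3 : measurableType d3) (D : set T1)
    (g : T2 -> T3) (f : T1 -> T2) :
  measurable_fun setT g -> measurable_fun D f ->
  measurable_fun D (fun x => g (f x)).
Proof. exact: measurableT_comp. Qed.

(** The closure lemmas above are stated for literal abstractions, so that matching on the head
    symbol of the body supplies the component functions explicitly and no higher-order unification
    is left. The constant case only fires when the body ignores the variable. *)
Ltac meas := repeat first [ assumption | match goal with
  | |- measurable_fun _ (fun z => @EFin _ (@?a z)) => apply: (@measurable_lamE _ _ _ _ a)
  | |- measurable_fun _ (fun z => @mule _ (@?a z) (@?b z)) => apply: (@measurable_lame _ _ _ _ a b)
  | |- measurable_fun _ (fun z => @GRing.mul _ (@?a z) (@?b z)) => apply: (@measurable_lamM _ _ _ _ a b)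
  | |- measurable_fun _ (fun z => @GRing.add _ (@?a z) (@?b z)) => apply: (@measurable_lamD _ _ _ _ a b)
  | |- measurable_fun _ (fun z => @GRing.opp _ (@?a z)) => apply: (@measurable_lamN _ _ _ _ a)
  | |- measurable_fun _ (fun z => @gauss _ ?v (@?a z)) => apply: (@measurable_lam_gauss _ _ _ _ v a)
  | |- measurable_fun _ (fun z => @expR _ (@?a z)) => apply: (@measurable_lam_expR _ _ _ _ a)
  | |- measurable_fun _ (fun z => @indic _ _ ?A (@?a z)) => apply: (@measurable_lam_indic _ _ _ _ A a)
  | |- measurable_fun _ (fun z => @GRing.add _ (@?a z) (@?b z)) => apply: (@measurable_lamade _ _ _ _ a b)
  | |- measurable_fun _ (fun z => @ind_le0 _ (@?a z)) => apply: (@measurable_lam_ind_le0 _ _ _ _ a)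
  | |- measurable_fun _ (fun z => fst z) => exact: measurable_fst
  | |- measurable_fun _ (fun z => snd z) => exact: measurable_snd
  | |- measurable_fun _ (fun z => fst (@?a z)) =>
      apply: (@measurable_lam_app _ _ _ _ _ _ _ fst a measurable_fst)
  | |- measurable_fun _ (fun z => snd (@?a z)) =>
      apply: (@measurable_lam_app _ _ _ _ _ _ _ snd a measurable_snd)
  | |- measurable_fun _ (fun z => z) => exact: measurable_id
  | |- measurable_fun _ (fun z => ?c) => exact: measurable_cst
  | |- measurable_fun _ (gauss _) => exact: measurable_gauss
  | mg : measurable_fun setT ?g |- measurable_fun _ (fun z => ?g (@?a z)) =>
      apply: (@measurable_lam_app _ _ _ _ _ _ _ g a mg)
  end ].

(** * Sums and differences of independent Gaussian variables *)

Section Rotation.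
Context {R : realType}.
Notation mu := (@lebesgue_measure R).

(** The exponents agree by the parallelogram identity; the factor 2 is the Jacobian of
    [(x, y) |-> (x + y, y - x)]. *)
Lemma gauss_rot (v x y : R) : 0 < v ->
  gauss v x * gauss v y = 2 * (gauss (v *+ 2) (x + y) * gauss (v *+ 2) (y - x)).
Proof.
move=> v0; have v20 : 0 < v *+ 2 by rewrite pmulrn_lgt0.
have pi0 := pi_gt0 R.
rewrite !gaussE// mulrACA [in RHS]mulrACA -!expRD -!invfM -!sqrtrM; last 2 first.
  by rewrite mulrn_wge0// mulr_ge0// ltW.
  by rewrite mulrn_wge0// mulr_ge0// ltW.
rewrite mulrA; congr (_ * expR _); last by field; rewrite gt_eqF.
have -> : v *+ 2 * pi *+ 2 * (v *+ 2 * pi *+ 2) = 2 ^+ 2 * (v * pi *+ 2 * (v * pi *+ 2)) by ring.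
set q := (v * pi *+ 2 * _); have -> : Num.sqrt (2 ^+ 2 * q) = 2 * Num.sqrt q.
  by rewrite sqrtrM ?sqr_ge0// sqrtr_sqr ger0_norm.
by rewrite invfM mulrA divff ?mul1r.
Qed.

Local Open Scope ereal_scope.

Context d (T : measurableType d) (P : probability T R).

(** The joint density is integrated with [u = y - x] as new inner variable; after exchanging the
    integrals, [w = u + 2 * x] replaces [x], and [gauss_rot] makes the integrand a product in [u]
    and [w]. *)
Lemma normal_rotation (X Y : T -> measurableTypeR R) (v : R) : (0 < v)%R ->
  measurable_fun setT X -> measurable_fun setT Y ->
  (forall A C, measurable A -> measurable C -> P (X @^-1` A `&` Y @^-1` C) =
    normal_prob 0 (Num.sqrt v) A * normal_prob 0 (Num.sqrt v) C) ->
  forall A C, measurable A -> measurable C ->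
  P ((fun w => Y w - X w)%R @^-1` A `&` (fun w => Y w + X w)%R @^-1` C) =
    normal_prob 0 (Num.sqrt (v *+ 2)) A * normal_prob 0 (Num.sqrt (v *+ 2)) C.
Proof.
move=> v0 mX mY H A C mA mC.
have v20 : (0 < v *+ 2)%R by rewrite pmulrn_lgt0.
have lawX A' : measurable A' -> P (X @^-1` A') = normal_prob 0 (Num.sqrt v) A'.
  by move=> mA'; have := H A' setT mA' measurableT;
    rewrite preimage_setT setIT probability_setT mule1.
pose f (x y : measurableTypeR R) : \bar R := (\1_A (y - x) * \1_C (y + x))%:E.
have f0 x y : 0 <= f x y by rewrite lee_fin mulr_ge0.
have mf : measurable_fun setT (fun z : measurableTypeR R * measurableTypeR R => f z.1 z.2).
  by rewrite /f; meas.
have mS : measurable ((fun w => Y w - X w)%R @^-1` A `&` (fun w => Y w + X w)%R @^-1` C).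
  apply: measurableI; rewrite -[X in measurable X]setTI.
    exact: (measurable_funB mY mX).
  exact: (measurable_funD mY mX).
transitivity (\int[P]_w f (X w) (Y w)).
  transitivity (\int[P]_w (\1_((fun w => Y w - X w)%R @^-1` A `&` (fun w => Y w + X w)%R @^-1` C) w)%:E).
    by rewrite integral_indic// setIT.
  by apply: eq_integral => w _; rewrite /f indicI.
rewrite (@independent_integral _ _ _ _ _ _ _ _ v)//; last first.
  by move=> A' C' mA' mC'; rewrite H// lawX.
rewrite (@integral_normal_rv _ _ _ _ _ v (fun x => \int[mu]_y (f x y * (gauss v y)%:E)))//; last 2 first.
- apply: (@measurable_fun_fubini_tonelli_F _ _ _ _ _ mu
    (fun z => (f z.1 z.2 * (gauss v z.2)%:E))).
    by rewrite /f; meas.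
  by move=> z; rewrite mule_ge0// lee_fin gauss_ge0.
- by move=> x; apply: integral_ge0 => y _; rewrite mule_ge0// lee_fin gauss_ge0.
transitivity (\int[mu]_x \int[mu]_u
  (\1_A u * \1_C (u + 2 * x) * gauss v (x + u) * gauss v x)%:E).
  apply: eq_integral => x _.
  rewrite -ge0_integralZr; first last.
  - by rewrite lee_fin gauss_ge0.
  - by move=> y _; rewrite mule_ge0// lee_fin gauss_ge0.
  - by rewrite /f; meas.
  - exact: measurableT.
  rewrite [LHS](ge0_integral_shift x); last 2 first.
  - by rewrite /f; meas.
  - by move=> y; rewrite !mule_ge0// lee_fin gauss_ge0.
  apply: eq_integral => y _; rewrite /f addrK -!EFinM.
  by rewrite (_ : y + x + x = y + 2 * x)%R; [rewrite [(y + x)%R]addrC|ring].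
rewrite (@fubini_tonelli _ _ _ _ _ mu mu (fun z => (\1_A z.2 * \1_C (z.2 + 2 * z.1) * gauss v (z.1 + z.2) * gauss v z.1)%:E))/=; last 2 first.
- by meas.
- by move=> z; rewrite lee_fin !mulr_ge0// gauss_ge0.
pose g := gauss (v *+ 2).
have g0 x : (0 <= g x)%R by exact: gauss_ge0.
transitivity (\int[mu]_u \int[mu]_w ((\1_A u * g u)%:E * (\1_C w * g w)%:E)).
  apply: eq_integral => u _.
  rewrite [RHS](ge0_integral_affine 2 u); first last.
  - by move=> x; rewrite mule_ge0// lee_fin mulr_ge0.
  - by rewrite /g; meas.
  - by [].
  rewrite -ge0_integralZl; first last.
  - by [].
  - by move=> x _; rewrite mule_ge0// lee_fin mulr_ge0.
  - by rewrite /g; meas.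
  - exact: measurableT.
  apply: eq_integral => x _; rewrite -!EFinM; congr EFin.
  rewrite [(u + _)%R]addrC -mulrA [(gauss v (x + u) * _)%R]mulrC gauss_rot// -/g.
  have -> : (x + (x + u) = 2 * x + u)%R by ring.
  have -> : (x + u - x = u)%R by ring.
  move: (\1_A u) (\1_C _) (g u) (g _) => i j k l; ring.
transitivity (\int[mu]_u ((\1_A u * g u)%:E * normal_prob 0 (Num.sqrt (v *+ 2)) C)).
  apply: eq_integral => u _; rewrite ge0_integralZl; first last.
  - by rewrite lee_fin mulr_ge0.
  - by move=> x _; rewrite lee_fin mulr_ge0.
  - by rewrite /g; meas.
  - exact: measurableT.
  by rewrite integral_indic_gauss.
rewrite ge0_integralZr; first last.
- exact: measure_ge0.
- by move=> x _; rewrite lee_fin mulr_ge0.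
- by rewrite /g; meas.
- exact: measurableT.
by rewrite integral_indic_gauss.
Qed.

End Rotation.

Lemma measurable_preimageT d1 d2 (T1 : measurableType d1) (T2 : measurableType d2)
    (X : T1 -> T2) (A : set T2) :
  measurable_fun setT X -> measurable A -> measurable (X @^-1` A).
Proof. by move=> mX mA; rewrite -[X in measurable X]setTI; exact: mX. Qed.

Section IndependentPairs.
Context {R : realType} d (T : measurableType d) (P : probability T R).
Local Open Scope ereal_scope.

(** [independent_pair] is used twice: it extends rectangles to [Z] while the second pair stays on a
    rectangle, then extends the latter to [Z']. [H0], which is [H] without [E], identifies the
    marginal laws of the two pairs. *)
Lemma independent_pairs d1 d2 d3 d4 (E1 : measurableType d1)
    (E2 : measurableType d2) (E3 : measurableType d3) (E4 : measurableType d4)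
    (S : T -> E1) (S' : T -> E2) (u : T -> E3) (v : T -> E4) (E : set T) :
  measurable_fun setT S -> measurable_fun setT S' ->
  measurable_fun setT u -> measurable_fun setT v -> measurable E ->
  (forall X C A A', measurable X -> measurable C -> measurable A -> measurable A' ->
    P ((S @^-1` X `&` u @^-1` A) `&` ((S' @^-1` C `&` v @^-1` A') `&` E)) =
    P (S @^-1` X) * P (u @^-1` A) * (P (S' @^-1` C) * P (v @^-1` A') * P E)) ->
  (forall X C A A', measurable X -> measurable C -> measurable A -> measurable A' ->
    P ((S @^-1` X `&` u @^-1` A) `&` (S' @^-1` C `&` v @^-1` A')) =
    P (S @^-1` X) * P (u @^-1` A) * (P (S' @^-1` C) * P (v @^-1` A'))) ->
  forall Z Z', measurable Z -> measurable Z' ->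
    P ((fun w => (S w, u w)) @^-1` Z `&` ((fun w => (S' w, v w)) @^-1` Z' `&` E)) =
    P ((fun w => (S w, u w)) @^-1` Z) * (P ((fun w => (S' w, v w)) @^-1` Z') * P E).
Proof.
move=> mS mS' mu mv mE H H0 Z Z' mZ mZ'.
have pT : P setT = 1 := probability_setT P.
have HSu X A : measurable X -> measurable A ->
    P (S @^-1` X `&` u @^-1` A) = P (S @^-1` X) * P (u @^-1` A).
  move=> mX mA; have := H0 X setT A setT mX measurableT mA measurableT.
  by rewrite !preimage_setT !setIT pT !mule1.
have HSv C A' : measurable C -> measurable A' ->
    P (S' @^-1` C `&` v @^-1` A') = P (S' @^-1` C) * P (v @^-1` A').
  move=> mC mA; have := H0 setT C setT A' measurableT mC measurableT mA.
  by rewrite !preimage_setT !setTI pT !mul1e.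
have HSvE C A' : measurable C -> measurable A' ->
    P ((S' @^-1` C `&` v @^-1` A') `&` E) = P (S' @^-1` C) * P (v @^-1` A') * P E.
  move=> mC mA; have := H setT C setT A' measurableT mC measurableT mA.
  by rewrite !preimage_setT !setTI pT !mul1e.
have HZ C A' : measurable C -> measurable A' ->
    P ((fun w => (S w, u w)) @^-1` Z `&` ((S' @^-1` C `&` v @^-1` A') `&` E)) =
    P ((fun w => (S w, u w)) @^-1` Z) * (P (S' @^-1` C) * P (v @^-1` A') * P E).
  move=> mC mA'; rewrite -HSvE//.
  apply: independent_pair => //.
  - by apply: measurableI => //; apply: measurableI; apply: measurable_preimageT.
  - by move=> X A mX mA; rewrite H// HSu// HSvE.
have mSu : measurable ((fun w => (S w, u w)) @^-1` Z).
  by apply: measurable_preimageT => //; exact: measurable_fun_pair.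
have HZE : P ((fun w => (S w, u w)) @^-1` Z `&` E) =
    P ((fun w => (S w, u w)) @^-1` Z) * P E.
  have := HZ setT setT measurableT measurableT.
  by rewrite !preimage_setT !setTI pT !mul1e.
rewrite setICA [RHS]muleCA -HZE.
apply: independent_pair => //; first exact: measurableI.
by move=> C A' mC mA'; rewrite setICA HZ// HSv// HZE muleCA.
Qed.

End IndependentPairs.

(** * Walks driven by the differences and by the sums of increments *)

Section Walk.
Context {R : realType} d (T : measurableType d) (P : probability T R).
Local Open Scope ereal_scope.
Variables (N : nat) (h : R) (h0 : (0 < h)%R) (xi eta : nat -> T -> measurableTypeR R).
Hypothesis mxi : forall i, measurable_fun setT (xi i).
Hypothesis meta : forall i, measurable_fun setT (eta i).

(** Constraints on the increments from [n] on, that is, on the future of the walks at time [n].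
    Taking [setT] everywhere removes them. *)
Definition tail_event (n : nat) (A A' : nat -> set (measurableTypeR R)) : set T :=
  [set w | forall i, (n <= i < N)%N -> A i (xi i w) /\ A' i (eta i w)].

Hypothesis indep : forall A A' : nat -> set (measurableTypeR R),
  (forall i, measurable (A i)) -> (forall i, measurable (A' i)) ->
  P (tail_event 0 A A') = \prod_(0 <= i < N)
    (normal_prob 0 (Num.sqrt h) (A i) * normal_prob 0 (Num.sqrt h) (A' i)).

Variables (d1 d2 : measure_display) (E1 : measurableType d1) (E2 : measurableType d2).
Variables (phi : nat -> E1 -> measurableTypeR R -> E1)
          (psi : nat -> E2 -> measurableTypeR R -> E2) (S0 : E1) (V0 : E2).
Hypothesis mphi : forall n, measurable_fun setT (fun z => phi n z.1 z.2).
Hypothesis mpsi : forall n, measurable_fun setT (fun z => psi n z.1 z.2).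

(** State space and update rule are left abstract so that the state can carry, besides the position,
    the running maximum of its excess over the barrier. *)
Fixpoint walk_diff (n : nat) (w : T) : E1 :=
  if n is m.+1 then phi m (walk_diff m w) (eta m w - xi m w)%R else S0.

Fixpoint walk_sum (n : nat) (w : T) : E2 :=
  if n is m.+1 then psi m (walk_sum m w) (eta m w + xi m w)%R else V0.

Let mu_ i : measurable_fun setT (fun w => eta i w - xi i w : measurableTypeR R)%R.
Proof. exact: (measurable_funB (meta i) (mxi i)). Qed.

Let mv_ i : measurable_fun setT (fun w => eta i w + xi i w : measurableTypeR R)%R.
Proof. exact: (measurable_funD (meta i) (mxi i)). Qed.

Lemma measurable_walk_diff n : measurable_fun setT (walk_diff n).
Proof.
elim: n => [|n IH] /=; first exact: measurable_cst.
exact: (measurableT_comp (mphi n) (measurable_fun_pair IH (mu_ n))).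
Qed.

Lemma measurable_walk_sum n : measurable_fun setT (walk_sum n).
Proof.
elim: n => [|n IH] /=; first exact: measurable_cst.
exact: (measurableT_comp (mpsi n) (measurable_fun_pair IH (mv_ n))).
Qed.

Lemma tail_eventE n A A' : (n < N)%N ->
  tail_event n A A' = (xi n @^-1` A n `&` eta n @^-1` A' n) `&` tail_event n.+1 A A'.
Proof.
move=> nN; apply/seteqP; split => w.
  move=> H; split; first by apply: H; rewrite leqnn.
  by move=> i /andP[/ltnW ni iN]; apply: H; rewrite ni.
move=> [[H1 H2] H] i /andP[]; rewrite leq_eqVlt => /predU1P[<-//|ni iN].
by apply: H; rewrite ni.
Qed.

Lemma tail_event_cons n (D D' : set (measurableTypeR R)) A A' : (n < N)%N ->
  (xi n @^-1` D `&` eta n @^-1` D') `&` tail_event n.+1 A A' =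
  tail_event n (fun i => if i == n then D else A i)
               (fun i => if i == n then D' else A' i).
Proof.
move=> nN; rewrite [RHS]tail_eventE//= eqxx; congr (_ `&` _).
apply/seteqP; split => w H i /[dup] /andP[ni _] /H;
  by rewrite gt_eqF.
Qed.

Lemma tail_eventT n : tail_event n (fun=> setT) (fun=> setT) = setT.
Proof. by apply/seteqP; split => // w _ i _. Qed.

Section tail.
Variables A A' : nat -> set (measurableTypeR R).
Hypothesis mA : forall i, measurable (A i).
Hypothesis mA' : forall i, measurable (A' i).

Lemma measurable_tail_event n : measurable (tail_event n A A').
Proof.
rewrite (_ : tail_event _ _ _ = \bigcap_(i in [set i | (n <= i < N)%N])
  (xi i @^-1` A i `&` eta i @^-1` A' i))//.
by apply: bigcap_measurableType => i _; apply: measurableI; apply: measurable_preimageT.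
Qed.

Lemma prob_tail_event n : (n <= N)%N -> P (tail_event n A A') =
  \prod_(n <= i < N)
    (normal_prob 0 (Num.sqrt h) (A i) * normal_prob 0 (Num.sqrt h) (A' i)).
Proof.
move=> nN.
have -> : tail_event n A A' = tail_event 0
    (fun i => if (i < n)%N then setT else A i) (fun i => if (i < n)%N then setT else A' i).
  apply/seteqP; split => w H i iN; have := H i.
    by case: (ltnP i n) => //= _; apply; case/andP: iN.
  by move: iN => /andP[ni iN]; rewrite iN (leq_gtF ni)/=; apply.
rewrite indep; last 2 first.
- by move=> i; case: ifP.
- by move=> i; case: ifP.
rewrite (@big_cat_nat _ _ _ n)//= [X in X * _]big_nat [X in X * _]big1 ?mul1e.
  apply: eq_big_nat => i /andP[ni _]; by rewrite (leq_gtF ni).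
by move=> i /andP[_ ->]; rewrite !probability_setT mule1.
Qed.

End tail.

Lemma prob_increment_tail n A A' D D' : (n < N)%N ->
  (forall i, measurable (A i)) -> (forall i, measurable (A' i)) ->
  measurable D -> measurable D' ->
  P ((xi n @^-1` D `&` eta n @^-1` D') `&` tail_event n.+1 A A') =
  normal_prob 0 (Num.sqrt h) D * normal_prob 0 (Num.sqrt h) D' *
  P (tail_event n.+1 A A').
Proof.
move=> nN mA mA' mD mD'; rewrite tail_event_cons// !prob_tail_event//; last 3 first.
- by move=> i; case: ifP.
- by move=> i; case: ifP.
- exact: ltnW.
rewrite big_ltn//= eqxx; congr (_ * _).
by apply: eq_big_nat => i /andP[ni _]; rewrite gt_eqF.
Qed.

Lemma prob_increment n D D' : (n < N)%N -> measurable D -> measurable D' ->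
  P (xi n @^-1` D `&` eta n @^-1` D') =
  normal_prob 0 (Num.sqrt h) D * normal_prob 0 (Num.sqrt h) D'.
Proof.
move=> nN mD mD'.
have := @prob_increment_tail n (fun=> setT) (fun=> setT) D D' nN.
by rewrite tail_eventT setIT probability_setT mule1; exact.
Qed.

Let u i w : measurableTypeR R := (eta i w - xi i w)%R.
Let v i w : measurableTypeR R := (eta i w + xi i w)%R.

Lemma prob_rotated_increment n D D' : (n < N)%N -> measurable D -> measurable D' ->
  P (u n @^-1` D `&` v n @^-1` D') =
  normal_prob 0 (Num.sqrt (h *+ 2)) D * normal_prob 0 (Num.sqrt (h *+ 2)) D'.
Proof.
move=> nN mD mD'; apply: (@normal_rotation _ _ _ _ (xi n) (eta n) h) => // C C' mC mC'.
exact: prob_increment.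
Qed.

Lemma prob_diff_increment n D : (n < N)%N -> measurable D ->
  P (u n @^-1` D) = normal_prob 0 (Num.sqrt (h *+ 2)) D.
Proof.
move=> nN mD; have := @prob_rotated_increment n D setT nN mD measurableT.
by rewrite preimage_setT setIT probability_setT mule1.
Qed.

Lemma prob_sum_increment n D : (n < N)%N -> measurable D ->
  P (v n @^-1` D) = normal_prob 0 (Num.sqrt (h *+ 2)) D.
Proof.
move=> nN mD; have := @prob_rotated_increment n setT D nN measurableT mD.
by rewrite preimage_setT setTI probability_setT mul1e.
Qed.

(** [F] is an event of the past. The pair [(xi n, eta n)] is independent of [F] together with the
    later increments, and the constraint on difference and sum is a measurable constraint on this
    pair. *)
Lemma prob_rotated_tail n A A' (F : set T) D D' : (n < N)%N ->
  (forall i, measurable (A i)) -> (forall i, measurable (A' i)) ->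
  measurable F ->
  (forall A A', (forall i, measurable (A i)) -> (forall i, measurable (A' i)) ->
    P (F `&` tail_event n A A') = P F * P (tail_event n A A')) ->
  measurable D -> measurable D' ->
  P ((u n @^-1` D `&` v n @^-1` D') `&` (F `&` tail_event n.+1 A A')) =
  P (u n @^-1` D) * P (v n @^-1` D') * (P F * P (tail_event n.+1 A A')).
Proof.
move=> nN mA mA' mF HF mD mD'.
have mtl : measurable (tail_event n.+1 A A') by exact: measurable_tail_event.
have mFt : measurable (F `&` tail_event n.+1 A A') by exact: measurableI.
have Hc C C' : measurable C -> measurable C' ->
  P ((xi n @^-1` C `&` eta n @^-1` C') `&` (F `&` tail_event n.+1 A A')) =
  P (xi n @^-1` C `&` eta n @^-1` C') * (P F * P (tail_event n.+1 A A')).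
  move=> mC mC'; rewrite setICA tail_event_cons// HF; last 2 first.
  - by move=> i; case: ifP.
  - by move=> i; case: ifP.
  by rewrite -tail_event_cons// prob_increment_tail// -(@prob_increment n C C')// muleCA.
have EF : P (F `&` tail_event n.+1 A A') = P F * P (tail_event n.+1 A A').
  have := Hc setT setT measurableT measurableT.
  by rewrite !preimage_setT !setTI probability_setT mul1e.
rewrite -EF prob_diff_increment// prob_sum_increment// -(@prob_rotated_increment n D D')//.
have := @independent_pair _ _ _ P _ _ _ _ (xi n) (eta n) _ (mxi n) (meta n) mFt.
rewrite EF => /(_ Hc) Hp.
have mZ : measurable [set z : measurableTypeR R * measurableTypeR R |
    D (z.2 - z.1)%R /\ D' (z.2 + z.1)%R].
  apply: measurableI; rewrite -[X in measurable X]setTI.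
  - by apply: (@measurable_funB _ _ _ setT snd fst).
  - by apply: (@measurable_funD _ _ _ setT snd fst).
exact: (Hp _ mZ).
Qed.

(* The walks built on the differences and on the sums are independent of each
   other and of the increments still to come. *)
Lemma walk_independent n : (n <= N)%N -> forall A A' X C,
  (forall i, measurable (A i)) -> (forall i, measurable (A' i)) ->
  measurable X -> measurable C ->
  P (walk_diff n @^-1` X `&` (walk_sum n @^-1` C `&` tail_event n A A')) =
  P (walk_diff n @^-1` X) * (P (walk_sum n @^-1` C) * P (tail_event n A A')).
Proof.
elim: n => [_ A A' X C mA mA' mX mC|n IH nN A A' X C mA mA' mX mC].
  have cst0 (E : Type) (Y : set E) (y : E) (F : set T) :
      P ((fun _ : T => y) @^-1` Y `&` F) = P ((fun _ : T => y) @^-1` Y) * P F.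
    have [yY|yY] := pselect (Y y).
      have -> : (fun _ : T => y) @^-1` Y = setT by apply/seteqP; split.
      by rewrite setTI probability_setT mul1e.
    have -> : (fun _ : T => y) @^-1` Y = set0 by apply/seteqP; split.
    by rewrite set0I measure0 mul0e.
  by rewrite /= !cst0.
have mS := measurable_walk_diff n; have mV := measurable_walk_sum n.
have mtl : measurable (tail_event n.+1 A A') by exact: measurable_tail_event.
have IHE X' C' B B' : measurable X' -> measurable C' ->
    (forall i, measurable (B i)) -> (forall i, measurable (B' i)) ->
    P ((walk_diff n @^-1` X' `&` walk_sum n @^-1` C') `&` tail_event n B B') =
    P (walk_diff n @^-1` X' `&` walk_sum n @^-1` C') * P (tail_event n B B').
  move=> mX' mC' mB mB'; rewrite -setIA IH// ?(ltnW nN)// muleA; congr (_ * _).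
  have := IH (ltnW nN) (fun=> setT) (fun=> setT) X' C'.
  by rewrite tail_eventT setIT probability_setT mule1 => ->.
have EXC X' C' : measurable X' -> measurable C' ->
    P (walk_diff n @^-1` X' `&` walk_sum n @^-1` C') =
    P (walk_diff n @^-1` X') * P (walk_sum n @^-1` C').
  move=> mX' mC'; have := IH (ltnW nN) (fun=> setT) (fun=> setT) X' C'.
  by rewrite tail_eventT setIT probability_setT mule1 => ->.
(* Past, present and future factor completely: [prob_rotated_tail] separates the rotated increments
   from the rest, and the induction hypothesis separates the two walks. *)
have K B B' X' C' D D' : (forall i, measurable (B i)) -> (forall i, measurable (B' i)) ->
    measurable X' -> measurable C' -> measurable D -> measurable D' ->
    P ((walk_diff n @^-1` X' `&` u n @^-1` D) `&`
       ((walk_sum n @^-1` C' `&` v n @^-1` D') `&` tail_event n.+1 B B')) =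
    P (walk_diff n @^-1` X') * P (u n @^-1` D) *
    (P (walk_sum n @^-1` C') * P (v n @^-1` D') * P (tail_event n.+1 B B')).
  move=> mB mB' mX' mC' mD mD'.
  have := @prob_rotated_tail n B B' (walk_diff n @^-1` X' `&` walk_sum n @^-1` C')
    D D' nN mB mB' _ _ mD mD'.
  rewrite EXC// => Q.
  transitivity (P ((u n @^-1` D `&` v n @^-1` D') `&`
    (walk_diff n @^-1` X' `&` walk_sum n @^-1` C' `&` tail_event n.+1 B B'))).
    by congr (P _); rewrite -!setIA; apply/seteqP; split => w /=; tauto.
  rewrite Q; last 2 first.
  - by apply: measurableI; apply: measurable_preimageT.
  - by move=> *; rewrite IHE// EXC.
  rewrite -!muleA [RHS]muleCA; congr (_ * _).
  by rewrite muleCA; congr (_ * _); rewrite muleCA.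
have := @independent_pairs _ _ _ P _ _ _ _ _ _ _ _ (walk_diff n) (walk_sum n)
  (u n) (v n) _ mS mV (mu_ n) (mv_ n) mtl.

have K0 X' C' D D' : measurable X' -> measurable C' -> measurable D -> measurable D' ->
    P ((walk_diff n @^-1` X' `&` u n @^-1` D) `&`
       (walk_sum n @^-1` C' `&` v n @^-1` D')) =
    P (walk_diff n @^-1` X') * P (u n @^-1` D) *
    (P (walk_sum n @^-1` C') * P (v n @^-1` D')).
  move=> mX' mC' mD mD'; have := K (fun=> setT) (fun=> setT) X' C' D D'.
  by rewrite tail_eventT setIT probability_setT mule1; exact.
(* The new states are functions of the pairs of old state and rotated increment, so [X] and [C] pull
   back to measurable sets of pairs. *)
move=> Q; have mZ := mphi n measurableT _ mX; have mZ' := mpsi n measurableT _ mC.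
rewrite !setTI in mZ mZ'.
apply: (Q _ _ _ _ mZ mZ') => //.
by move=> X' C' D D' mX' mC' mD mD'; exact: K.
Qed.

End Walk.

(** * Heat kernel and images *)

Section Heat.
Context {R : realType}.
Notation mu := (@lebesgue_measure R).
Local Open Scope ereal_scope.

(** The heat semigroup: a Gaussian step of variance [v] acting on test functions. *)
Definition heat (v : R) (g : measurableTypeR R -> \bar R) (z : measurableTypeR R) : \bar R :=
  \int[mu]_y (g y * (gauss v (y - z))%:E).

Variables (g : measurableTypeR R -> \bar R).
Hypotheses (mg : measurable_fun setT g) (g0 : forall y, 0 <= g y).

Lemma heat_ge0 v z : 0 <= heat v g z.
Proof. by apply: integral_ge0 => y _; rewrite mule_ge0// lee_fin gauss_ge0. Qed.

Lemma measurable_heat v : measurable_fun setT (heat v g).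
Proof.
have H := @measurable_fun_fubini_tonelli_F _ _ (measurableTypeR R) (measurableTypeR R) R mu
  (fun z => g z.2 * (gauss v (z.2 - z.1))%:E).
apply: H; first by meas.
by move=> z /=; rewrite mule_ge0// lee_fin gauss_ge0.
Qed.

Lemma integral_gauss_shift (v s : R) :
  \int[mu]_x (gauss v (x - s))%:E = 1.
Proof.
rewrite -(integral_gauss v) [RHS](ge0_integral_shift (- s)%R)//.
- by meas.
- by move=> x; rewrite lee_fin gauss_ge0.
Qed.

(** Chapman-Kolmogorov: the last step, of variance [q], is absorbed into the test function. *)
Lemma heat_conv (v q s : R) : (0 < v)%R -> (0 < q)%R ->
  \int[mu]_y (g y * (gauss (v + q) (y - s))%:E) =
  \int[mu]_z ((gauss v (z - s))%:E * heat q g z).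
Proof.
move=> v0 q0.
transitivity (\int[mu]_y \int[mu]_z
    (g y * ((gauss v (z - s))%:E * (gauss q (y - z))%:E))).
  apply: eq_integral => y _; rewrite ge0_integralZl; first last.
  - exact: g0.
  - by move=> z _; rewrite mule_ge0// lee_fin gauss_ge0.
  - by meas.
  - exact: measurableT.
  suff -> : \int[mu]_z ((gauss v (z - s))%:E * (gauss q (y - z))%:E) = (gauss (v + q) (y - s))%:E by [].
  apply: etrans (gauss_conv _ _ (y - s) v0 q0).
  rewrite [RHS](ge0_integral_shift (- s)%R); first last.
  - by move=> z; rewrite mule_ge0// lee_fin gauss_ge0.
  - by meas.
  apply: eq_integral => z _.
  set r := (y - s - (z - s))%R; suff -> : r = (y - z)%R by [].
  rewrite /r; ring.
rewrite (@fubini_tonelli _ _ _ _ _ mu mu (fun p =>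
  g p.1 * ((gauss v (p.2 - s))%:E * (gauss q (p.1 - p.2))%:E)))/=; first last.
- by move=> p; rewrite !mule_ge0// lee_fin gauss_ge0.
- by meas.
apply: eq_integral => z _; rewrite -ge0_integralZl; first last.
- by rewrite lee_fin gauss_ge0.
- by move=> y _; rewrite mule_ge0// lee_fin gauss_ge0.
- by meas.
- exact: measurableT.
by apply: eq_integral => y _; rewrite muleCA.
Qed.

(** Conservation of mass keeps the jump error of the upper bound from growing as steps are peeled
    off. *)
Lemma heat_mass (q : R) : (0 < q)%R ->
  \int[mu]_z heat q g z = \int[mu]_y g y.
Proof.
move=> q0; rewrite /heat.
rewrite (@fubini_tonelli _ _ _ _ _ mu mu (fun p =>
  g p.2 * (gauss q (p.2 - p.1))%:E))/=; first last.
- by move=> p; rewrite !mule_ge0// lee_fin gauss_ge0.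
- by meas.
apply: eq_integral => y _; rewrite ge0_integralZl; first last.
- exact: g0.
- by move=> z _; rewrite lee_fin gauss_ge0.
- by meas.
- exact: measurableT.
rewrite -[RHS]mule1 -(integral_gauss_shift q y); congr (_ * _).
by apply: eq_integral => z _; rewrite -opprB gauss_opp.
Qed.

(** The jump estimate: from [z], the support of [g] is reached only by moving down by at least
    [r]. *)
Lemma heat_le (q r z c : R) : (0 < q)%R -> (0 <= r)%R ->
  (forall y, (c < y)%R -> g y = 0) -> (c + r <= z)%R ->
  heat q g z <= (gauss q r)%:E * \int[mu]_y g y.
Proof.
move=> q0 r0 gc cz; rewrite -ge0_integralZl; first last.
- by rewrite lee_fin gauss_ge0.
- by move=> y _.
- by meas.
- exact: measurableT.
apply: ge0_le_integral => //.
- by move=> y _; rewrite mule_ge0// lee_fin gauss_ge0.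
- by meas.
- by meas.
move=> y _; have [/gc ->|yc] := ltP c y; first by rewrite mul0e mule0.
rewrite muleC lee_wpmul2r// lee_fin -opprB gauss_opp// le_gauss//.
by rewrite lerBrDr (le_trans _ cz)// addrC lerD2r.
Qed.

End Heat.

Section Image.
Context {R : realType}.
Implicit Types a b h x z : R.

(** The weight is the one for which the log-ratio of image to source factors into the signed
    distances of [x] to the barrier at time 0 and of [z] to the barrier at time [h]. Both
    comparisons below read off its sign. *)
Lemma gauss_image a b h x z : 0 < h ->
  expR (- (b * (a - x))) * gauss (h *+ 2) (z - (2 * a - x)) =
  gauss (h *+ 2) (z - x) * expR ((a - x) * (z - (a + b * h)) / h).
Proof.
move=> h0; have h20 : 0 < h *+ 2 by rewrite pmulrn_lgt0.
rewrite !gaussE// mulrCA -!mulrA -!expRD; congr (_ * expR _).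
by field; rewrite gt_eqF.
Qed.

Lemma gauss_image_ge a b h x z : 0 < h -> x <= a -> a + b * h <= z ->
  gauss (h *+ 2) (z - x) <= expR (- (b * (a - x))) * gauss (h *+ 2) (z - (2 * a - x)).
Proof.
move=> h0 xa zc; rewrite gauss_image// ler_peMr ?gauss_ge0// -expR0 ler_expR.
by rewrite divr_ge0 ?(ltW h0)// mulr_ge0 ?subr_ge0.
Qed.

Lemma gauss_image_le a b h x z : 0 < h -> x <= a -> z <= a + b * h ->
  expR (- (b * (a - x))) * gauss (h *+ 2) (z - (2 * a - x)) <= gauss (h *+ 2) (z - x).
Proof.
move=> h0 xa zc; rewrite gauss_image// ler_piMr ?gauss_ge0// expR_le1.
by rewrite ler_pdivrMr// mul0r mulr_ge0_le0 ?subr_ge0 ?subr_le0.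
Qed.

End Image.

(** * Closed forms *)

Section ExpIntegral.
Context {R : realType}.
Notation mu := (@lebesgue_measure R).

Lemma is_derive_expR_scale (b x : R) : b != 0 ->
  is_derive x (1:R) (fun y => b^-1 * expR (b * y)) (expR (b * x)).
Proof.
move=> b0.
have H1 : is_derive x (1:R) (fun y : R => b * y) b.
  by apply: is_derive_eq; rewrite /GRing.scale/= mulr1.
have H2 : is_derive x (1:R) (fun y : R => expR (b * y)) (b * expR (b * x)).
  by have := @is_derive1_comp R expR (fun y => b * y) x (expR (b * x)) b _ H1; rewrite [b * expR _]mulrC => H; apply: H.
apply: is_derive_eq.
by rewrite /GRing.scale/= mulKf.
Qed.

Lemma integral_expR_itv (b l a : R) : b != 0 -> l <= a ->
  (\int[mu]_(x in `[l, a]) (expR (b * x))%:E =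
  ((expR (b * a) - expR (b * l)) / b)%:E)%E.
Proof.
move=> b0; rewrite le_eqVlt => /predU1P[->|la].
  by rewrite subrr mul0r set_itv1 integral_set1.
have dF x := @is_derive_expR_scale b x b0.
rewrite (@continuous_FTC2 _ _ (fun y => b^-1 * expR (b * y)) l a la).
- by rewrite -EFinB; congr EFin; field.
- apply: continuous_subspaceT => x; apply: continuous_comp; last exact: continuous_expR.
  exact: mulrl_continuous.
- have cF x : (fun y => b^-1 * expR (b * y)) @ x --> b^-1 * expR (b * x).
    have /derivable1_diffP H : derivable (fun y => b^-1 * expR (b * y)) x 1 by case: (dF x).
    exact: (differentiable_continuous H).
  split.
  + by move=> x _; case: (dF x).
  + exact/cvg_at_right_filter.
  + exact/cvg_at_left_filter.
- by move=> x _; rewrite derive1E; case: (dF x).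
Qed.

Local Open Scope ereal_scope.

Lemma integral_expR_ind (b l a : R) : b != 0%R ->
  \int[mu]_x (ind_le0 (x - a) * ind_le0 (l - x) * expR (b * x))%:E =
  (ind_le0 (l - a) * ((expR (b * a) - expR (b * l)) / b))%:E.
Proof.
move=> b0; have [la|al] := leP l a; last first.
  rewrite [in RHS]/ind_le0 subr_le0 leNgt al mul0r.
  rewrite integral0_eq// => x _; rewrite /ind_le0 !subr_le0.
  by case: (leP x a) => xa; rewrite ?mul0r// leNgt (le_lt_trans xa al) mulr0 mul0r.
rewrite [in RHS]/ind_le0 subr_le0 la mul1r -integral_expR_itv//.
rewrite [RHS]integral_mkcond; apply: eq_integral => x _.
rewrite patchE mem_setE in_itv/= andbC /ind_le0 !subr_le0 -natrM mulnb.
by case: ifP => _; rewrite ?mul1r ?mul0r.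
Qed.

(** The distribution function of [N(0, v)], kept extended-real for use inside nonnegative integrals;
    [cumr] is its real value. *)
Definition cum (v t : R) : \bar R := \int[mu]_u (ind_le0 (u - t) * gauss v u)%:E.

Lemma measurable_cum v : measurable_fun setT (cum v).
Proof.
have H := @measurable_fun_fubini_tonelli_F _ _ (measurableTypeR R) (measurableTypeR R) R mu
  (fun z => (ind_le0 (z.2 - z.1) * gauss v z.2)%:E).
apply: H; first by meas.
by move=> z /=; rewrite lee_fin mulr_ge0 ?gauss_ge0.
Qed.

Lemma cum_ge0 v t : 0 <= cum v t.
Proof. by apply: integral_ge0 => u _; rewrite lee_fin mulr_ge0 ?gauss_ge0. Qed.

Lemma cum_le1 v t : cum v t <= 1.
Proof.
rewrite -(integral_gauss v); apply: ge0_le_integral => //.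
- by move=> u _; rewrite lee_fin mulr_ge0 ?gauss_ge0.
- by meas.
- by meas.
- move=> u _; rewrite lee_fin ler_piMl ?gauss_ge0//.
  by rewrite /ind_le0; case: (u - t <= 0)%R; rewrite ?ler01 ?lexx.
Qed.

Definition cumr v t : R := fine (cum v t).

Lemma cumE v t : cum v t = (cumr v t)%:E.
Proof.
rewrite /cumr fineK// ge0_fin_numE ?cum_ge0//.
by rewrite (le_lt_trans (cum_le1 v t))// ltry.
Qed.

Lemma cumr_ge0 v t : (0 <= cumr v t)%R.
Proof. by rewrite -lee_fin -cumE cum_ge0. Qed.

Lemma cumr_Phi t : cumr 1 t = std_Phi t.
Proof.
rewrite /cumr /cum /std_Phi; congr fine; rewrite [RHS]integral_mkcond.
apply: eq_integral => u _; rewrite patchE mem_setE in_itv/= /ind_le0 subr_le0 gauss1.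
by case: ifP => _; rewrite ?mul1r ?mul0r.
Qed.

Lemma cum_shift v t s :
  \int[mu]_u (ind_le0 (u - t) * gauss v (u - s))%:E = cum v (t - s).
Proof.
rewrite (ge0_integral_shift s); first last.
- by move=> u; rewrite lee_fin mulr_ge0 ?gauss_ge0.
- by meas.
by apply: eq_integral => u _; rewrite addrK opprB addrA addrAC.
Qed.

Lemma integrable_ind_gauss v t s : mu.-integrable setT
  (fun u => (ind_le0 (u - t) * gauss v (u - s))%:E).
Proof.
apply/integrableP; split; first by meas.
under eq_integral do rewrite gee0_abs ?lee_fin ?mulr_ge0 ?gauss_ge0//.
by rewrite cum_shift cumE ltry.
Qed.

(** After exchanging the integrals, the inner one is an exponential over [u - s <= x <= a], whose
    primitive is explicit. The lower end contributes [expR (b * u)], absorbed by a shift of the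
    Gaussian. *)
Lemma integral_expR_cum (v b a s : R) : (0 < v)%R -> b != 0%R ->
  \int[mu]_x ((ind_le0 (x - a) * expR (b * x))%:E * cum v (x + s)) =
  ((expR (b * a) * cumr v (a + s) -
    expR (v * b ^+ 2 / 2 - b * s) * cumr v (a + s - v * b)) / b)%:E.
Proof.
move=> v0 b0.
transitivity (\int[mu]_x \int[mu]_u ((ind_le0 (x - a) * expR (b * x))%:E *
    (ind_le0 (u - (x + s)) * gauss v u)%:E)).
  apply: eq_integral => x _; rewrite ge0_integralZl//; first by meas.
  - by move=> u _; rewrite lee_fin mulr_ge0 ?gauss_ge0.
  - by rewrite lee_fin mulr_ge0 ?expR_ge0.
rewrite (@fubini_tonelli _ _ _ _ _ mu mu (fun p => (ind_le0 (p.1 - a) * expR (b * p.1))%:E *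
    (ind_le0 (p.2 - (p.1 + s)) * gauss v p.2)%:E))/=; first last.
- by move=> p; rewrite -EFinM lee_fin !mulr_ge0 ?gauss_ge0 ?expR_ge0.
- by meas.
transitivity (\int[mu]_u ((expR (b * a) / b * (ind_le0 (u - (a + s)) * gauss v (u - 0)))%:E -
  (expR (v * b ^+ 2 / 2 - b * s) / b * (ind_le0 (u - (a + s)) * gauss v (u - v * b)))%:E)).
  apply: eq_integral => u _.
  transitivity (\int[mu]_x ((gauss v u)%:E * (ind_le0 (x - a) * ind_le0 (u - s - x) * expR (b * x))%:E)).
    apply: eq_integral => x _; rewrite -!EFinM; congr EFin.
    have -> : (u - (x + s) = u - s - x)%R by ring.
    move: (ind_le0 _) (ind_le0 _) (expR _) (gauss _ _) => i j k l; ring.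
  rewrite ge0_integralZl//; first last.
  - by rewrite lee_fin gauss_ge0.
  - by move=> x _; rewrite lee_fin !mulr_ge0 ?expR_ge0.
  - by meas.
  rewrite integral_expR_ind// -EFinM -EFinB; congr EFin.
  have -> : (u - s - a = u - (a + s))%R by ring.
  rewrite subr0.
  (* Exponential tilting: it moves the mean from 0 to [v * b]. *)
  have -> : gauss v (u - v * b) = (gauss v u * expR (b * (u - s)) * expR (b * s - v * b ^+ 2 / 2))%R.
    rewrite !gaussE// -!mulrA -!expRD; congr (_ * expR _)%R.
    by field; rewrite gt_eqF.
  have E : (expR (v * b ^+ 2 / 2 - b * s) * expR (b * s - v * b ^+ 2 / 2) = 1)%R.
    by rewrite -expRD (_ : _ + _ = 0)%R ?expR0//; ring.
  move: E; set X := expR (_ - b * s); set Y := expR (b * s - _) => E.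
  move: (ind_le0 _) (expR (b * a)) (expR (b * (u - s))) (gauss v u) => i j k g.
  have -> : (X / b * (i * (g * k * Y)) = (X * Y) * (i * g * k / b))%R by ring.
  by rewrite E mul1r; ring.
(* The sign of [b] is free, so the two terms may be negative and the integral is split by
   integrability. *)
rewrite (@integralB_EFin _ _ _ mu setT
  (fun u => expR (b * a) / b * (ind_le0 (u - (a + s)) * gauss v (u - 0)))%R
  (fun u => expR (v * b ^+ 2 / 2 - b * s) / b * (ind_le0 (u - (a + s)) * gauss v (u - v * b)))%R)//; first last.
- by apply: eq_integrable (integrableZl _ (expR (v * b ^+ 2 / 2 - b * s) / b) (integrable_ind_gauss v (a + s) (v * b))).
- by apply: eq_integrable (integrableZl _ (expR (b * a) / b) (integrable_ind_gauss v (a + s) 0)).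
under eq_integral do rewrite EFinM.
rewrite integralZl//; last exact: integrable_ind_gauss.
under [X in _ - X]eq_integral do rewrite EFinM.
rewrite integralZl//; last exact: integrable_ind_gauss.
rewrite !cum_shift !cumE subr0 -!EFinM -EFinB; congr EFin; ring.
Qed.

End ExpIntegral.

Section EndpointIntegrals.
Context {R : realType}.
Notation mu := (@lebesgue_measure R).
Local Open Scope ereal_scope.
Implicit Types a b c x y : R.

(* By [gauss_rot], this is the joint law of the endpoints [S 0] and [S 1]. *)
Lemma integral_endpoints a c :
  \int[mu]_x ((ind_le0 (x - a))%:E * \int[mu]_y
    ((ind_le0 (y - c))%:E * (2 * gauss (1 *+ 2) (x + y))%:E *
     (gauss (1 *+ 2) (y - x))%:E)) = (cumr 1 a * cumr 1 c)%:E.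
Proof.
transitivity (\int[mu]_x ((ind_le0 (x - a) * gauss 1 x)%:E * (cumr 1 c)%:E)).
  apply: eq_integral => x _.
  rewrite EFinM -muleA; congr (_ * _); rewrite -cumE -ge0_integralZl//; first last.
  - by rewrite lee_fin gauss_ge0.
  - by move=> y _; rewrite lee_fin mulr_ge0 ?gauss_ge0.
  - by meas.
  apply: eq_integral => y _; rewrite -!EFinM -!mulrA; congr EFin.
  by rewrite [RHS]mulrCA (@gauss_rot _ 1 x y).
rewrite ge0_integralZr//; first last.
- by rewrite lee_fin cumr_ge0.
- by move=> y _; rewrite lee_fin mulr_ge0 ?gauss_ge0.
- by meas.
by rewrite -/(cum 1 a) cumE -EFinM.
Qed.

(* Closed form of the image term, for end points below [a] and [c] and an image
   taken with respect to a barrier starting at [a']. *)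
Definition image_value b a a' c : R :=
  gauss 1 a' * expR (- (b * a')) *
  ((expR (b * a) * cumr 1 (a + (c - a')) -
    expR (1 * b ^+ 2 / 2 - b * (c - a')) * cumr 1 (a + (c - a') - 1 * b)) / b).

(** Applied at [a'] and [y - (a' - x)], [gauss_rot] turns the weight times the image density into a
    product whose first factor is constant. The inner integral is then a multiple of [cum], and
    [integral_expR_cum] finishes. *)
Lemma integral_image b a a' c : b != 0%R ->
  \int[mu]_x ((ind_le0 (x - a) * expR (- (b * (a' - x))))%:E * \int[mu]_y
    ((ind_le0 (y - c))%:E * (2 * gauss (1 *+ 2) (x + y))%:E *
     (gauss (1 *+ 2) (y - (2 * a' - x)))%:E)) = (image_value b a a' c)%:E.
Proof.
move=> b0; rewrite /image_value EFinM -integral_expR_cum// -ge0_integralZl//; first last.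
- by rewrite lee_fin mulr_ge0 ?gauss_ge0 ?expR_ge0.
- by move=> x _; rewrite mule_ge0 ?cum_ge0// lee_fin mulr_ge0 ?expR_ge0.
- by have mc := @measurable_cum R 1; meas.
apply: eq_integral => x _.
rewrite muleA -EFinM.
transitivity ((ind_le0 (x - a) * expR (- (b * (a' - x))))%:E * ((gauss 1 a')%:E * cum 1 (x + (c - a')))).
  congr (_ * _); rewrite (_ : x + (c - a') = c - (a' - x))%R; last by ring.
  rewrite -cum_shift -ge0_integralZl//; first last.
  - by rewrite lee_fin gauss_ge0.
  - by move=> y _; rewrite lee_fin mulr_ge0 ?gauss_ge0.
  - by meas.
  apply: eq_integral => y _; rewrite -!EFinM -!mulrA; congr EFin.
  rewrite [RHS]mulrCA (@gauss_rot _ 1 a' (y - (a' - x)))//.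
  have -> : (a' + (y - (a' - x)) = x + y)%R by ring.
  by have -> : (y - (a' - x) - a' = y - (2 * a' - x))%R by ring.
rewrite muleA -EFinM; congr (EFin _ * _).
have -> : (- (b * (a' - x)) = - (b * a') + b * x)%R by ring.
by rewrite expRD; ring.
Qed.

(** This integral multiplies the jump error, so only its finiteness matters. Its value comes from
    [integral_expR_cum] with variance 2. *)
Lemma integral_image_mass b a a' c : b != 0%R ->
  exists K : R, \int[mu]_x ((ind_le0 (x - a) * expR (- (b * (a' - x))))%:E * \int[mu]_y
    ((ind_le0 (y - c))%:E * (2 * gauss (1 *+ 2) (x + y))%:E)) = K%:E.
Proof.
move=> b0.
have v0 : (0 < 1 *+ 2 :> R)%R by [].
exists (2 * expR (- (b * a')) * ((expR (b * a) * cumr (1 *+ 2) (a + c) -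
    expR ((1 *+ 2) * b ^+ 2 / 2 - b * c) * cumr (1 *+ 2) (a + c - (1 *+ 2) * b)) / b))%R.
rewrite EFinM -integral_expR_cum// -ge0_integralZl//; first last.
- by move=> x _; rewrite mule_ge0 ?cum_ge0// lee_fin mulr_ge0 ?expR_ge0.
- by have mc := @measurable_cum R (1 *+ 2); meas.
apply: eq_integral => x _.
transitivity ((ind_le0 (x - a) * expR (- (b * (a' - x))))%:E * (2%:E * cum (1 *+ 2) (x + c))).
  congr (_ * _); rewrite (_ : x + c = c - - x)%R; last by ring.
  rewrite -cum_shift -ge0_integralZl//; first last.
  - by move=> y _; rewrite lee_fin mulr_ge0 ?gauss_ge0.
  - by meas.
  apply: eq_integral => y _; rewrite -!EFinM; congr EFin.
  by rewrite opprK [(y + x)%R]addrC mulrCA.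
rewrite !muleA -!EFinM; congr (EFin _ * _).
have -> : (- (b * (a' - x)) = - (b * a') + b * x)%R by ring.
by rewrite expRD; ring.
Qed.

End EndpointIntegrals.

(** * Random walk below a line *)

Section StartingPoint.
Context {R : realType} d (T : measurableType d) (P : probability T R).
Notation mu := (@lebesgue_measure R).
Local Open Scope ereal_scope.

(* [V] plays the part of [S 0 + S 1] and [U] that of [S 1 - S 0], so that
   [x = (V - U) / 2] is [S 0]; [M] is the running maximum of the excess of
   [S - S 0] over the barrier. *)
Lemma prob_starting_point (U M V : T -> measurableTypeR R) (a : R) :
  measurable_fun setT U -> measurable_fun setT M -> measurable_fun setT V ->
  (forall w, (- a <= M w)%R) ->
  (forall X C, measurable X -> measurable C ->
    P ((fun w => (U w, M w)) @^-1` X `&` V @^-1` C) =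
    P ((fun w => (U w, M w)) @^-1` X) * normal_prob 0 (Num.sqrt (1 *+ 2)) C) ->
  P [set w | ((V w - U w) / 2 + M w <= 0)%R] =
  \int[mu]_x ((ind_le0 (x - a))%:E * \int[P]_w ((ind_le0 (M w + x))%:E *
    (2 * gauss (1 *+ 2) (x + (U w + x)))%:E)).
Proof.
move=> mU mM mV aM H.
pose f (z : measurableTypeR R * measurableTypeR R) (v : measurableTypeR R) : \bar R :=
  (@ind_le0 R ((v - z.1) / 2 + z.2))%:E.
have mE : measurable [set w | ((V w - U w) / 2 + M w <= 0)%R].
  have mF : measurable_fun setT (fun w => (V w - U w) / 2 + M w : measurableTypeR R)%R by meas.
  have := mF measurableT [set` `]-oo, 0%R]] (measurable_itv _); rewrite setTI.
  by congr measurable; apply/seteqP; split => w /=; rewrite in_itv.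
transitivity (\int[P]_w f (U w, M w) (V w)).
  transitivity (\int[P]_w (\1_[set w | ((V w - U w) / 2 + M w <= 0)%R] w)%:E).
    by rewrite integral_indic// setIT.
  by apply: eq_integral => w _; rewrite /f indicE mem_setE.
rewrite (@independent_integral _ _ _ _ _ _ (fun w => (U w, M w)) V (1 *+ 2))//; first last.
- by move=> z y; rewrite lee_fin.
- by rewrite /f; meas.
- exact: measurable_fun_pair.
transitivity (\int[P]_w \int[mu]_x ((ind_le0 (x - a))%:E * ((ind_le0 (M w + x))%:E *
    (2 * gauss (1 *+ 2) (x + (U w + x)))%:E))).
  apply: eq_integral => w _.
  (* Substituting [v = 2 * x + U w] makes the starting point [x] the variable and produces the
     factor 2. *)
  rewrite [LHS](ge0_integral_affine 2 (U w))//; first last.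
  - by move=> v; rewrite mule_ge0// lee_fin ?gauss_ge0.
  - by rewrite /f; meas.
  rewrite -ge0_integralZl//; first last.
  - by move=> v _; rewrite mule_ge0// lee_fin ?gauss_ge0.
  - by rewrite /f; meas.
  apply: eq_integral => x _; rewrite /f -!EFinM; congr EFin => /=.
  have -> : ((2 * x + U w - U w) / 2 + M w = M w + x)%R by field.
  have -> : (2 * x + U w = x + (U w + x))%R by ring.
  (* The indicator of [x <= a] comes for free from [- a <= M w]; the image comparisons need this
     range. *)
  rewrite mulrCA; have [xa|ax] := leP x a.
    by rewrite {2}/ind_le0 subr_le0 xa mul1r.
  have -> : ind_le0 (M w + x) = 0%R.
    by rewrite /ind_le0 leNgt (_ : 0 < M w + x)%R// -[X in (X < _)%R](addNr a) ler_ltD.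
  by rewrite !mul0r mulr0.
rewrite (@fubini_tonelli _ _ _ _ _ P mu (fun p => (ind_le0 (p.2 - a))%:E *
  ((ind_le0 (M p.1 + p.2))%:E * (2 * gauss (1 *+ 2) (p.2 + (U p.1 + p.2)))%:E)))/=; first last.
- by move=> p; rewrite !mule_ge0// lee_fin ?mulr_ge0 ?gauss_ge0.
- by meas.
apply: eq_integral => x _; rewrite ge0_integralZl//; first last.
- by rewrite lee_fin.
- by move=> w _; rewrite mule_ge0// lee_fin ?mulr_ge0 ?gauss_ge0.
- by meas.
Qed.

End StartingPoint.

Section Barrier.
Context {R : realType} d (T : measurableType d) (P : probability T R).
Notation mu := (@lebesgue_measure R).
Local Open Scope ereal_scope.
Variables (N : nat) (a b h : R) (h0 : (0 < h)%R).
Variables (U M u : nat -> T -> measurableTypeR R).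
Hypotheses (mU : forall n, measurable_fun setT (U n))
  (mM : forall n, measurable_fun setT (M n)).
Hypotheses (U0 : forall w, U 0%N w = 0%R) (M0 : forall w, M 0%N w = (- a)%R).
Hypothesis US : forall n w, U n.+1 w = (U n w + u n w)%R.

Definition barrier n : R := (a + b * (n%:R * h))%R.

Hypothesis MS : forall n w, M n.+1 w = Num.max (M n w) (U n.+1 w - barrier n.+1)%R.
Hypothesis law_step : forall n (f : measurableTypeR R * measurableTypeR R -> measurableTypeR R -> \bar R),
  (n < N)%N -> measurable_fun setT (fun z => f z.1 z.2) ->
  (forall z y, 0 <= f z y) ->
  \int[P]_w f (U n w, M n w) (u n w) =
  \int[P]_w \int[mu]_y (f (U n w, M n w) y * (gauss (h *+ 2) y)%:E).

(** The walk started at [x] and killed at the barrier, tested at time [n]. Using test functions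
    instead of a density lets an induction replace [g]. *)
Definition survive n (x : R) (g : measurableTypeR R -> \bar R) : \bar R :=
  \int[P]_w ((ind_le0 (M n w + x))%:E * g (U n w + x)%R).

Let below n (g : measurableTypeR R -> \bar R) (y : measurableTypeR R) : \bar R :=
  (ind_le0 (y - barrier n))%:E * g y.

Let below_ge0 n g : (forall y, 0 <= g y) -> forall y, 0 <= below n g y.
Proof. by move=> g0 y; rewrite mule_ge0// lee_fin. Qed.

Let mbelow n g : measurable_fun setT g -> measurable_fun setT (below n g).
Proof. by move=> mg; rewrite /below; meas. Qed.

(** Integrates out the last increment: the constraint at time [n + 1] cuts [g] off, and the free
    step smooths the result. *)
Lemma survive_step n x g : (n < N)%N -> measurable_fun setT g ->
  (forall y, 0 <= g y) ->
  survive n.+1 x g = survive n x (heat (h *+ 2) (below n.+1 g)).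
Proof.
move=> nN mg g0.
pose f (z : measurableTypeR R * measurableTypeR R) (y : measurableTypeR R) : \bar R :=
  (ind_le0 (z.2 + x))%:E * below n.+1 g (z.1 + y + x)%R.
transitivity (\int[P]_w f (U n w, M n w) (u n w)).
  apply: eq_integral => w _; rewrite /f /below /= MS US muleA -EFinM.
  congr (EFin _ * _); rewrite /ind_le0 -natrM mulnb; congr (_%:R).
  rewrite addr_maxl ge_max; congr (nat_of_bool (_ && (_ <= _)%R)).
  by rewrite addrAC.
rewrite law_step//; first last.
- by move=> z y; rewrite mule_ge0 ?lee_fin// below_ge0.
- by rewrite /f /below; meas.
apply: eq_integral => w _; rewrite /heat -ge0_integralZl; first last.
- by rewrite lee_fin.
- by move=> y _; rewrite mule_ge0 ?lee_fin ?gauss_ge0// below_ge0.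
- by rewrite /below; meas.
- exact: measurableT.
rewrite [RHS](ge0_integral_shift (U n w + x)%R); first last.
- by move=> y; rewrite !mule_ge0 ?lee_fin ?gauss_ge0// below_ge0.
- by rewrite /below; meas.
apply: eq_integral => y _; rewrite /f /= muleA.
have -> : (y + (U n w + x) = U n w + y + x :> R)%R by ring.
have -> : (U n w + y + x - (U n w + x) = y :> R)%R by ring.
by rewrite /below !muleA.
Qed.

Lemma survive0 x g : (x <= a)%R -> survive 0 x g = g x.
Proof.
move=> xa; rewrite /survive; under eq_integral => w _.
  rewrite U0 M0 add0r (_ : ind_le0 _ = 1%R) ?mul1e; last first.
    by rewrite /ind_le0 addrC subr_le0 xa.
  over.
by rewrite integral_cst// [X in _ * X](_ : _ = 1) ?mule1//; exact: probability_setT.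
Qed.

Let above n (g : measurableTypeR R -> \bar R) (y : measurableTypeR R) : \bar R :=
  (1 - @ind_le0 R (y - barrier n))%:E * g y.

Let ind_le1 (t : R) : (0 <= 1 - ind_le0 t)%R.
Proof. by rewrite /ind_le0; case: (t <= 0)%R; rewrite /= ?subrr ?subr0. Qed.

Let above_ge0 n g : (forall y, 0 <= g y) -> forall y, 0 <= above n g y.
Proof. by move=> g0 y; apply: mule_ge0 => //; rewrite lee_fin; exact: ind_le1. Qed.

Let mabove n g : measurable_fun setT g -> measurable_fun setT (above n g).
Proof. by move=> mg; rewrite /above; meas. Qed.

Let below_above n g y : (forall y, 0 <= g y) -> below n g y + above n g y = g y.
Proof.
move=> g0; rewrite /below /above -ge0_muleDl ?lee_fin//.
by rewrite -EFinD addrCA subrr addr0 mul1e.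
Qed.

Let var n : R := ((n%:R * h) *+ 2)%R.

Let varS n : (var n + h *+ 2)%R = var n.+1.
Proof. by rewrite /var -mulrnDl -[n.+1]addn1 natrD mulrDl mul1r. Qed.

Let var_gt0 n : (0 < var n.+1)%R.
Proof. by rewrite /var pmulrn_lgt0// mulr_gt0. Qed.

Let var1 : var 1 = (h *+ 2)%R. Proof. by rewrite /var mul1r. Qed.

Let int_ge0 (f : R -> \bar R) : (forall y, 0 <= f y) -> 0 <= \int[mu]_y f y.
Proof. by move=> f0; apply: integral_ge0. Qed.

Let q0 : (0 < h *+ 2)%R. Proof. by rewrite pmulrn_lgt0. Qed.

Let prod_ge0 (f : R -> \bar R) v s : (forall y, 0 <= f y) ->
  forall y, 0 <= f y * (gauss v (y - s))%:E.
Proof. by move=> f0 y; rewrite mule_ge0// lee_fin gauss_ge0. Qed.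

(* Beyond the barrier the image term dominates [p], so replacing [p] by its part
   below the barrier at each step loses at most the image term. *)
Lemma survive_lower n x g : (n < N)%N -> (x <= a)%R -> measurable_fun setT g ->
  (forall y, 0 <= g y) ->
  \int[mu]_y (below n.+1 g y * (gauss (var n.+1) (y - x))%:E) <=
  survive n.+1 x g + (expR (- (b * (a - x))))%:E *
    \int[mu]_y (below n.+1 g y * (gauss (var n.+1) (y - (2 * a - x)))%:E).
Proof.
move=> nN xa; set k := (expR _)%:E; have k0 : 0 <= k by rewrite lee_fin expR_ge0.
elim: n nN g => [nN|n IH nN] g mg g0.
  rewrite survive_step// survive0// var1 /heat leeDl// mule_ge0// int_ge0//.
  by apply: prod_ge0; exact: below_ge0.
have b0 := below_ge0 n.+2 g g0; have mb := mbelow n.+2 g mg.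
rewrite -!(varS n.+1) !heat_conv// survive_step//.
set G := heat _ _.
have G0 z : 0 <= G z by exact: heat_ge0.
have mG : measurable_fun setT G by exact: measurable_heat.
have mbG := mbelow n.+1 G mG; have maG := mabove n.+1 G mG.
have bG0 := below_ge0 n.+1 G G0; have aG0 := above_ge0 n.+1 G G0.
pose p z := gauss (var n.+1) (z - x); pose im z := gauss (var n.+1) (z - (2 * a - x)).
have -> : \int[mu]_z ((im z)%:E * G z) =
    \int[mu]_z (below n.+1 G z * (im z)%:E) + \int[mu]_z (above n.+1 G z * (im z)%:E).
  rewrite -ge0_integralD; first last.
  - by rewrite /im; meas.
  - by move=> z _; exact: prod_ge0.
  - by rewrite /im; meas.
  - by move=> z _; exact: prod_ge0.
  - exact: measurableT.
  apply: eq_integral => z _; rewrite -ge0_muleDl ?lee_fin//.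
  by rewrite below_above// muleC.
rewrite ge0_muleDr ?int_ge0//; try exact: prod_ge0.
(* The induction hypothesis for [G] accounts for the part below the barrier. What is left holds
   pointwise: equality below, [gauss_image_ge] above. *)
rewrite addeA; apply: le_trans (leeD (IH (ltnW nN) G mG G0) (lexx _)).
rewrite -ge0_integralZl//; first last.
- by move=> z _; exact: prod_ge0.
- by rewrite /im; meas.
rewrite -ge0_integralD; first last.
- by rewrite /im; meas.
- by move=> z _; apply: mule_ge0 => //; exact: prod_ge0.
- by meas.
- by move=> z _; exact: prod_ge0.
- exact: measurableT.
apply: ge0_le_integral => //.
- by move=> z _; rewrite muleC; exact: prod_ge0.
- by rewrite /p; meas.
- by rewrite /im; meas.
move=> z _; rewrite /below /above /ind_le0 /=.
have [zc|zc] := leP (z - barrier n.+1)%R 0%R.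
  by rewrite subrr mul0e mul0e mule0 adde0 mul1e muleC.
rewrite mul0e mul0e add0e subr0 mul1e muleCA -EFinM muleC lee_wpmul2l// lee_fin.
apply: gauss_image_ge => //; first by rewrite mulr_gt0.
by move: zc; rewrite subr_gt0 => /ltW.
Qed.

(* Here the image is taken in the barrier raised by [e]: between the two barriers
   it is still dominated by [p], and mass above the raised barrier returns below
   the next one only by a jump of size at least [e / 2]. *)
Lemma survive_upper (e : R) n x g : (n < N)%N -> (x <= a)%R -> (0 < e)%R ->
  (b * h <= e / 2)%R -> measurable_fun setT g -> (forall y, 0 <= g y) ->
  survive n.+1 x g + (expR (- (b * (a + e - x))))%:E *
    \int[mu]_y (below n.+1 g y * (gauss (var n.+1) (y - (2 * (a + e) - x)))%:E) <=
  \int[mu]_y (below n.+1 g y * (gauss (var n.+1) (y - x))%:E) +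
  (n.+1%:R * (expR (- (b * (a + e - x))) * gauss (h *+ 2) (e / 2)))%:E *
    \int[mu]_y below n.+1 g y.
Proof.
move=> nN xa e0 bhe; set k := expR _; have k0 : (0 <= k)%R by exact: expR_ge0.
set delta := (k * _)%R; have delta0 : (0 <= delta)%R by rewrite mulr_ge0 ?gauss_ge0.
have e20 : (0 <= e / 2)%R by rewrite divr_ge0 ?ltW.
have xae : (x <= a + e)%R by rewrite (le_trans xa)// lerDl ltW.
have barrierS m : (barrier m.+1 = barrier m + b * h)%R.
  by rewrite /barrier -[m.+1]addn1 natrD; ring.
have above_barrier m y z : (barrier m.+1 < y)%R -> below m.+1 z y = 0.
  by move=> my; rewrite /below /ind_le0 subr_le0 leNgt my/= mul0e.
elim: n nN g => [nN|n IH nN] g mg g0.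
  have b0 := below_ge0 1 g g0; have mb := mbelow 1 g mg.
  rewrite survive_step// survive0// var1 mul1r /heat leeD2l//.
  rewrite -ge0_integralZl; first last.
  - by rewrite lee_fin.
  - by move=> y _; exact: prod_ge0.
  - by meas.
  - exact: measurableT.
  rewrite -ge0_integralZl; first last.
  - by rewrite lee_fin.
  - by [].
  - by [].
  - exact: measurableT.
  apply: ge0_le_integral => //.
  - by move=> y _; rewrite mule_ge0 ?lee_fin//; exact: prod_ge0.
  - by meas.
  - by meas.
  move=> y _; have [/above_barrier->|yc] := ltP (barrier 1) y.
    by rewrite mul0e !mule0.
  rewrite muleCA -EFinM muleC lee_wpmul2r// lee_fin /delta ler_wpM2l//.
  rewrite -opprB gauss_opp// le_gauss//.
  (* The image centre is at least [a + 2 * e] since [x <= a], while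
     [y <= a + b * h <= a + e / 2]. *)
  by move: yc; rewrite /barrier mul1r; lra.
have b0 := below_ge0 n.+2 g g0; have mb := mbelow n.+2 g mg.
rewrite -!(varS n.+1) !heat_conv// survive_step//.
have EI := heat_mass _ mb b0 _ q0.
have HLE z := heat_le _ mb b0 _ _ z _ q0 e20 (fun y => above_barrier n.+1 y g).
set G := heat _ _ in EI *.
have G0 z : 0 <= G z by exact: heat_ge0.
have mG : measurable_fun setT G by exact: measurable_heat.
have mbG := mbelow n.+1 G mG; have maG := mabove n.+1 G mG.
have bG0 := below_ge0 n.+1 G G0; have aG0 := above_ge0 n.+1 G G0.
pose p z := gauss (var n.+1) (z - x).
pose im z := gauss (var n.+1) (z - (2 * (a + e) - x)).
set I := \int[mu]_y below n.+2 g y in EI *.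
have I0 : 0 <= I by exact: int_ge0.
have pE : \int[mu]_z ((p z)%:E * G z) =
    \int[mu]_z (below n.+1 G z * (p z)%:E) + \int[mu]_z (above n.+1 G z * (p z)%:E).
  rewrite -ge0_integralD; first last.
  - by rewrite /p; meas.
  - by move=> z _; exact: prod_ge0.
  - by rewrite /p; meas.
  - by move=> z _; exact: prod_ge0.
  - exact: measurableT.
  apply: eq_integral => z _; rewrite -ge0_muleDl ?lee_fin//.
  by rewrite below_above// muleC.
(* Three regions: below the barrier the image stays as it is; up to the raised barrier
   [gauss_image_le] bounds it by [p]; beyond, [G] is at most the jump density times [I]. The error
   is spread over [im], of mass 1, to be compared pointwise. *)
have imE : k%:E * \int[mu]_z ((im z)%:E * G z) <=
    k%:E * \int[mu]_z (below n.+1 G z * (im z)%:E) +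
    \int[mu]_z (above n.+1 G z * (p z)%:E) + delta%:E * I.
  rewrite -[X in delta%:E * X]mul1e -(integral_gauss_shift (var n.+1) (2 * (a + e) - x)).
  rewrite muleA [X in X * I]muleC -muleA.
  have dI0 : 0 <= delta%:E * I by rewrite mule_ge0.
  rewrite -(@ge0_integralZr _ _ _ mu setT measurableT _ _ _ _ dI0)//; first last.
  - by move=> z _; rewrite lee_fin gauss_ge0.
  - by meas.
  rewrite -ge0_integralZl//; first last.
  - by move=> z _; rewrite muleC; exact: prod_ge0.
  - by rewrite /im; meas.
  rewrite -ge0_integralZl//; first last.
  - by move=> z _; exact: prod_ge0.
  - by rewrite /im; meas.
  rewrite -ge0_integralD//; first last.
  - by rewrite /p; meas.
  - by move=> z _; exact: prod_ge0.
  - by rewrite /im; meas.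
  - by move=> z _; rewrite mule_ge0 ?lee_fin//; exact: prod_ge0.
  rewrite -ge0_integralD//; first last.
  - by meas.
  - by move=> z _; rewrite mule_ge0// lee_fin gauss_ge0.
  - by rewrite /p /im; meas.
  - by move=> z _; rewrite adde_ge0//; [rewrite mule_ge0 ?lee_fin//|]; exact: prod_ge0.
  apply: ge0_le_integral => //.
  - by move=> z _; rewrite mule_ge0 ?lee_fin// muleC; exact: prod_ge0.
  - by rewrite /im; meas.
  - by rewrite /p /im; meas.
  move=> z _; rewrite -/(im z).
  have im0 : (0 <= im z)%R by exact: gauss_ge0.
  have [zc|zc] := leP z (barrier n.+1).
    have -> : below n.+1 G z = G z.
      by rewrite /below /ind_le0 subr_le0 zc mul1e.
    rewrite [G z * _]muleC -addeA leeDl// adde_ge0//; first exact: prod_ge0.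
    by rewrite mule_ge0.
  have -> : below n.+1 G z = 0.
    by rewrite /below /ind_le0 subr_le0 leNgt zc mul0e.
  have -> : above n.+1 G z = G z.
    by rewrite /above /ind_le0 subr_le0 leNgt zc subr0 mul1e.
  rewrite mul0e mule0 add0e; have [ze|ze] := leP z (barrier n.+1 + e)%R.
    rewrite muleA -EFinM muleC; apply: (@le_trans _ _ (G z * (p z)%:E)).
      rewrite lee_wpmul2l// lee_fin; apply: gauss_image_le => //.
        by rewrite mulr_gt0.
      by rewrite addrAC.
    by rewrite leeDl// mule_ge0.
  apply: (@le_trans _ _ ((im z)%:E * (delta%:E * I))); last first.
    by rewrite leeDr//; exact: prod_ge0.
  rewrite muleCA lee_wpmul2l// EFinM -muleA lee_wpmul2l//.
  (* The barrier rises by at most [e / 2] in one step, so half of the gap [e] is left to be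
     jumped. *)
  apply: (HLE z); apply: le_trans (ltW ze); rewrite (barrierS n.+1); lra.
have IH' : survive n.+1 x G + k%:E * \int[mu]_z (below n.+1 G z * (im z)%:E) <=
    \int[mu]_z (below n.+1 G z * (p z)%:E) + (n.+1%:R * delta)%:E * I.
  apply: le_trans (IH (ltnW nN) G mG G0) _.
  apply: leeD2l; apply: lee_wpmul2l; first by rewrite lee_fin mulr_ge0.
  (* Cutting [G] off only lowers its mass, which is [I]; hence each step adds the same error. *)
  rewrite -EI; apply: ge0_le_integral => //.
  by move=> z _; rewrite -[leRHS](below_above n.+1)// leeDl.
rewrite -/p in pE; rewrite pE; apply: le_trans (leeD (lexx _) imE) _.
have dS : (n.+2%:R * delta)%:E * I = (n.+1%:R * delta)%:E * I + delta%:E * I.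
  rewrite -[n.+2]addn1 natrD mulrDl mul1r EFinD.
  by rewrite ge0_muleDl// lee_fin mulr_ge0.
rewrite dS {imE pE dS}.
move: (survive _ _ _) (\int[mu]_z (below _ _ _ * (im _)%:E)) (\int[mu]_z (below _ _ _ * (p _)%:E))
  (\int[mu]_z (above _ _ _ * (p _)%:E)) (_ * I) (_ * I) IH' => s kB Bp Ap nI dI IH'.
rewrite addeA addeA [leRHS]addeA leeD2r// [leRHS]addeAC leeD2r//.
Qed.

Variable V : T -> measurableTypeR R.
Hypothesis mV : measurable_fun setT V.
Hypothesis N0 : (0 < N)%N.
Hypothesis Nh : (N%:R * h = 1)%R.
Hypothesis indV : forall X C, measurable X -> measurable C ->
    P ((fun w => (U N w, M N w)) @^-1` X `&` V @^-1` C) =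
    P ((fun w => (U N w, M N w)) @^-1` X) * normal_prob 0 (Num.sqrt (1 *+ 2)) C.

(** The density of [V] at [x + y], with the factor 2 from solving for the starting point. *)
Let g (x y : measurableTypeR R) : \bar R := (2 * gauss (1 *+ 2) (x + y))%:E.

Let g0 x y : 0 <= g x y. Proof. by rewrite lee_fin mulr_ge0 ?gauss_ge0. Qed.

Let mg x : measurable_fun setT (g x). Proof. by rewrite /g; meas. Qed.

Definition grid_event : set T := [set w | ((V w - U N w) / 2 + M N w <= 0)%R].

Lemma max_ge_start n w : (- a <= M n w)%R.
Proof. by elim: n => [|n IH]; rewrite ?M0// MS le_max IH. Qed.

Lemma prob_grid_event : P grid_event =
  \int[mu]_x ((ind_le0 (x - a))%:E * survive N x (g x)).
Proof. exact: prob_starting_point (mU N) (mM N) mV (max_ge_start N) indV. Qed.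

Let varN : var N = (1 *+ 2)%R. Proof. by rewrite /var Nh. Qed.

Let barrierN : barrier N = (a + b)%R. Proof. by rewrite /barrier Nh mulr1. Qed.

Let msurvive : measurable_fun setT (fun x : measurableTypeR R => survive N x (g x)).
Proof.
have H := @measurable_fun_fubini_tonelli_F _ _ (measurableTypeR R) _ R P
  (fun z => (ind_le0 (M N z.2 + z.1))%:E * (2 * gauss (1 *+ 2) (z.1 + (U N z.2 + z.1)))%:E).
apply: H; first by have mUN := mU N; have mMN := mM N; meas.
by move=> z; rewrite mule_ge0 ?lee_fin// mulr_ge0 ?gauss_ge0.
Qed.

Let endpoint (s : measurableTypeR R -> R) (x : measurableTypeR R) : \bar R :=
  \int[mu]_y ((ind_le0 (y - (a + b)))%:E * (2 * gauss (1 *+ 2) (x + y))%:E *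
     (gauss (1 *+ 2) (y - s x))%:E).

Let mendpoint (s : measurableTypeR R -> measurableTypeR R) :
  measurable_fun setT s -> measurable_fun setT (endpoint s).
Proof.
move=> ms.
have H := @measurable_fun_fubini_tonelli_F _ _ (measurableTypeR R) (measurableTypeR R) R mu
  (fun z => (ind_le0 (z.2 - (a + b)))%:E * (2 * gauss (1 *+ 2) (z.1 + z.2))%:E *
     (gauss (1 *+ 2) (z.2 - s z.1))%:E).
apply: H; first by meas.
by move=> z; rewrite !mule_ge0 ?lee_fin ?mulr_ge0 ?gauss_ge0.
Qed.

Let endpoint_ge0 s x : 0 <= endpoint s x.
Proof.
apply: integral_ge0 => y _.
by rewrite !mule_ge0 ?lee_fin ?mulr_ge0 ?gauss_ge0.
Qed.

Let survive_ge0 x : 0 <= survive N x (g x).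
Proof. by apply: integral_ge0 => y _; rewrite mule_ge0 ?lee_fin ?mulr_ge0 ?gauss_ge0. Qed.

Let image_weight (a' x : R) : \bar R := (ind_le0 (x - a) * expR (- (b * (a' - x))))%:E.

Let image_weight_ge0 a' x : 0 <= image_weight a' x.
Proof. by rewrite lee_fin mulr_ge0 ?expR_ge0. Qed.

Let mimage_endpoint a' : measurable_fun setT
  (fun x : measurableTypeR R => image_weight a' x * endpoint (fun x => 2 * a' - x)%R x).
Proof.
apply: measurable_lame; first by rewrite /image_weight; meas.
by apply: mendpoint; meas.
Qed.

Let msurvive_weighted : measurable_fun setT
  (fun x : measurableTypeR R => (ind_le0 (x - a))%:E * survive N x (g x)).
Proof. by apply: measurable_lame => //; meas. Qed.

Let mendpoint_id : measurable_fun setT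
  (fun x : measurableTypeR R => (ind_le0 (x - a))%:E * endpoint id x).
Proof. by apply: measurable_lame; [meas|apply: mendpoint; meas]. Qed.

Let ind_out x : (a < x)%R -> ind_le0 (x - a) = 0%R.
Proof. by move=> ax; rewrite /ind_le0 subr_le0 leNgt ax. Qed.

Let ind_in x : (x <= a)%R -> ind_le0 (x - a) = 1%R.
Proof. by move=> xa; rewrite /ind_le0 subr_le0 xa. Qed.

Lemma grid_event_lower : b != 0%R ->
  (cumr 1 a * cumr 1 (a + b))%:E <= P grid_event + (image_value b a a (a + b))%:E.
Proof.
move=> b0; rewrite prob_grid_event -integral_endpoints -integral_image//.
rewrite -(@ge0_integralD _ _ _ mu)//; first last.
- exact: mimage_endpoint.
- by move=> x _; apply: mule_ge0; [exact: image_weight_ge0|exact: (endpoint_ge0 (fun x => 2 * a - x)%R)].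
- by move=> x _; rewrite mule_ge0 ?lee_fin.
apply: ge0_le_integral => //.
- by move=> x _; apply: mule_ge0; [rewrite lee_fin|exact: (endpoint_ge0 id)].
- exact: (measurable_lamade _ _ _ _ _ _ msurvive_weighted (mimage_endpoint a)).
move=> x _; have [xa|/ind_out ->] := leP x a; last by rewrite mul0r !mul0e adde0.
rewrite ind_in// !mul1r !mul1e.
have := @survive_lower N.-1 x (g x); rewrite prednK// leqnn => /(_ isT xa (mg x) (g0 x)).
by rewrite varN /below barrierN.
Qed.

(** Only the image is taken in the raised barrier; the end points remain below [a] and [a + b]. The
    error of [survive_upper] depends on [x] through the image weight, so it is integrated as
    well. *)
Lemma grid_event_upper (e : R) : b != 0%R -> (0 < e)%R -> (b * h <= e / 2)%R ->
  P grid_event + (image_value b a (a + e) (a + b))%:E <=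
  (cumr 1 a * cumr 1 (a + b))%:E + (N%:R * gauss (h *+ 2) (e / 2))%:E *
  \int[mu]_x (image_weight (a + e) x * \int[mu]_y
    ((ind_le0 (y - (a + b)))%:E * (2 * gauss (1 *+ 2) (x + y))%:E)).
Proof.
move=> b0 e0 bhe; rewrite prob_grid_event -integral_endpoints -integral_image//.
pose mass (x : measurableTypeR R) := \int[mu]_y ((ind_le0 (y - (a + b)))%:E * (2 * gauss (1 *+ 2) (x + y))%:E).
have mass0 x : 0 <= mass x.
  by apply: integral_ge0 => y _; rewrite mule_ge0 ?lee_fin ?mulr_ge0 ?gauss_ge0.
have mmass : measurable_fun setT mass.
  have H := @measurable_fun_fubini_tonelli_F _ _ (measurableTypeR R) (measurableTypeR R) R mu
    (fun z => (ind_le0 (z.2 - (a + b)))%:E * (2 * gauss (1 *+ 2) (z.1 + z.2))%:E).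
  apply: H; first by meas.
  by move=> z; rewrite mule_ge0 ?lee_fin ?mulr_ge0 ?gauss_ge0.
have mwm : measurable_fun setT (fun x : measurableTypeR R => image_weight (a + e) x * mass x).
  by apply: measurable_lame => //; rewrite /image_weight; meas.
have c0 : (0 <= N%:R * gauss (h *+ 2) (e / 2))%R by rewrite mulr_ge0 ?gauss_ge0.
rewrite -(@ge0_integralD _ _ _ mu)//; first last.
- exact: mimage_endpoint.
- by move=> x _; apply: mule_ge0; [exact: image_weight_ge0|exact: (endpoint_ge0 (fun x => 2 * (a + e) - x)%R)].
- by move=> x _; rewrite mule_ge0 ?lee_fin.
rewrite -ge0_integralZl//; first last.
- by move=> x _; apply: mule_ge0; [exact: image_weight_ge0|exact: mass0].
rewrite -ge0_integralD//; first last.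
- by apply: measurable_lame => //; meas.
- move=> x _; apply: mule_ge0; first by rewrite lee_fin.
  by apply: mule_ge0; [exact: image_weight_ge0|exact: mass0].
- by move=> x _; apply: mule_ge0; [rewrite lee_fin|exact: (endpoint_ge0 id)].
apply: ge0_le_integral => //.
- move=> x _; apply: adde_ge0; first by rewrite mule_ge0 ?lee_fin.
  by apply: mule_ge0; [exact: image_weight_ge0|exact: (endpoint_ge0 (fun x => 2 * (a + e) - x)%R)].
- exact: (measurable_lamade _ _ _ _ _ _ msurvive_weighted (mimage_endpoint (a + e))).
- apply: (measurable_lamade _ _ _ _ _ _ mendpoint_id).
  by apply: measurable_lame => //; meas.
move=> x _; rewrite /image_weight; have [xa|/ind_out ->] := leP x a; last first.
  by rewrite !mul0r !mul0e mule0 adde0.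
rewrite ind_in// !mul1r !mul1e.
have := @survive_upper e N.-1 x (g x); rewrite prednK// leqnn.
move=> /(_ isT xa e0 bhe (mg x) (g0 x)).
rewrite varN /below barrierN; set k := expR _; set q := gauss _ (e / 2).
have -> : (N%:R * (k * q) = N%:R * q * k)%R by ring.
by rewrite EFinM -muleA.
Qed.

End Barrier.

(** * The Slepian process *)

Section SlepianGrid.
Context {R : realType} d (T : measurableType d) (P : probability T R).
Variables (B : R -> T -> R) (hB : is_std_brownian P B).
Variables (N : nat) (N0 : (0 < N)%N) (a b : R).

Let h : R := N%:R^-1.

Let h0 : 0 < h. Proof. by rewrite invr_gt0 ltr0n. Qed.

Let Nh : N%:R * h = 1. Proof. by rewrite mulfV// pnatr_eq0 -lt0n. Qed.

Let xi (i : nat) (w : T) : measurableTypeR R := B (i.+1%:R * h) w - B (i%:R * h) w.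
Let eta (i : nat) (w : T) : measurableTypeR R :=
  B ((N + i).+1%:R * h) w - B ((N + i)%:R * h) w.

Let mB t : 0 <= t -> measurable_fun setT (B t : T -> measurableTypeR R).
Proof. by case: hB => _ _ + _; exact. Qed.

Let grid_ge0 n : 0 <= n%:R * h. Proof. by rewrite mulr_ge0// ltW. Qed.

Let mxi i : measurable_fun setT (xi i).
Proof. by apply: (@measurable_funB _ _ _ _ (B _) (B _)); exact: mB. Qed.

Let meta i : measurable_fun setT (eta i).
Proof. by apply: (@measurable_funB _ _ _ _ (B _) (B _)); exact: mB. Qed.

Let gridS n : n.+1%:R * h - n%:R * h = h.
Proof. by rewrite -mulrBl -natrB// subSnn mul1r. Qed.

Let indep (A A' : nat -> set (measurableTypeR R)) :
  (forall i, measurable (A i)) -> (forall i, measurable (A' i)) ->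
  (P (tail_event _ T N xi eta 0 A A') = \prod_(0 <= i < N)
    (normal_prob 0 (Num.sqrt h) (A i) * normal_prob 0 (Num.sqrt h) (A' i)))%E.
Proof.
move=> mA mA'; case: hB => _ _ _ hinc.
have NiN i : (N + i < N)%N = false by rewrite ltnNge leq_addr.
(* Glues both families on the grid of [[0, 2]]: the first [N] increments are the [xi], the next [N]
   the [eta]. *)
pose A2 i := if (i < N)%N then A i else A' (i - N)%N.
have := hinc (N + N)%N (fun i => i%:R * h) A2.
have -> : [set w | forall i, (i < N + N)%N -> A2 i (B (i.+1%:R * h) w - B (i%:R * h) w)] =
    tail_event _ T N xi eta 0 A A'.
  apply/seteqP; split => w /= H i.
    move=> /andP[_ iN]; split.
      by have := H i; rewrite /A2 iN; apply; rewrite (leq_trans iN)// leq_addr.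
    have := H (N + i)%N; rewrite /A2 NiN addKn; apply.
    by rewrite ltn_add2l.
  rewrite /A2; case: (ltnP i N) => [iN _|Ni iNN]; first by have [] := H i iN.
  have iN : (i - N < N)%N by rewrite ltn_subLR.
  by have [_] := H _ iN; rewrite /eta subnKC.
have mA2 i : measurable (A2 i) by rewrite /A2; case: ifP.
have ts_lt i : (i < N + N)%N -> i%:R * h < i.+1%:R * h by rewrite -subr_gt0 gridS.
move=> -> //; last by rewrite mul0r.
under eq_bigr do rewrite gridS.
rewrite big_split_ord/= EFinM.
have fE D : measurable D -> (fine (normal_prob 0 (Num.sqrt h) D))%:E = normal_prob 0 (Num.sqrt h) D.
  by move=> mD; rewrite fineK// fin_num_measure.
rewrite big_split/=; congr (_ * _)%E.
  rewrite big_mkord -prodEFin; apply: eq_bigr => i _.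
  by rewrite /A2 ltn_ord fE.
rewrite big_mkord -prodEFin; apply: eq_bigr => i _.
by rewrite /A2 NiN addKn fE.
Qed.

Let phi (n : nat) (z : measurableTypeR R * measurableTypeR R) (u : measurableTypeR R) :
  measurableTypeR R * measurableTypeR R :=
  (z.1 + u, Num.max z.2 (z.1 + u - barrier a b h n.+1)).

Let psi (n : nat) (z u : measurableTypeR R) : measurableTypeR R := z + u.

Let mphi n : measurable_fun setT (fun z => phi n z.1 z.2).
Proof.
apply: measurable_fun_pair => /=; first by meas.
by apply: measurable_maxr; meas.
Qed.

Let mpsi n : measurable_fun setT (fun z => psi n z.1 z.2).
Proof. by rewrite /psi; meas. Qed.

(** The initial maximum [- a] is the excess of position 0 over the barrier at time 0, so the grid
    point 0 is included. *)
Let S := walk_diff _ T xi eta _ _ phi (0, - a).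
Let U n w := (S n w).1.
Let M n w := (S n w).2.
Let V := walk_sum _ T xi eta _ _ psi 0.

(** Since [S 0 = B 1], this says that [U n] is [S (n / N) - S 0]; the companion [VE] gives
    [V N = B 2]. *)
Let UE n w : U n w = B ((N + n)%:R * h) w - B 1 w - B (n%:R * h) w.
Proof.
elim: n => [|n IH].
  by rewrite addn0 Nh mul0r subrr sub0r; case: hB => ->; rewrite oppr0.
rewrite /U /= -/(U n w) IH /xi /eta addnS; ring.
Qed.

Let VE n w : V n w = B ((N + n)%:R * h) w - B 1 w + B (n%:R * h) w.
Proof.
elim: n => [|n IH].
  by rewrite addn0 Nh mul0r subrr add0r; case: hB => ->.
rewrite /V /= -/(V n w) /psi IH /xi /eta addnS; ring.
Qed.

Let mS n : measurable_fun setT (S n).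
Proof. by apply: (measurable_walk_diff _ _ _ _ mxi meta). Qed.

Let mU n : measurable_fun setT (U n : T -> measurableTypeR R).
Proof. exact: (measurable_lam_app _ _ _ _ _ _ _ fst (S n) measurable_fst (mS n)). Qed.

Let mM n : measurable_fun setT (M n : T -> measurableTypeR R).
Proof. exact: (measurable_lam_app _ _ _ _ _ _ _ snd (S n) measurable_snd (mS n)). Qed.

Let mV n : measurable_fun setT (V n : T -> measurableTypeR R).
Proof. by apply: (measurable_walk_sum _ _ _ _ mxi meta). Qed.

Let walk_ind := walk_independent _ T P N h h0 xi eta mxi meta indep _ _ _ _ phi psi
  (0, - a) 0 mphi mpsi.

Let pT : (P setT = 1)%E. Proof. exact: probability_setT. Qed.

Let walk_tail n (X : set (measurableTypeR R * measurableTypeR R)) A A' : (n <= N)%N ->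
  measurable X -> (forall i, measurable (A i)) -> (forall i, measurable (A' i)) ->
  (P (S n @^-1` X `&` tail_event _ T N xi eta n A A') =
   P (S n @^-1` X) * P (tail_event _ T N xi eta n A A'))%E.
Proof.
move=> nN mX mA mA'; have := walk_ind n nN A A' X setT mA mA' mX measurableT.
by rewrite preimage_setT setTI pT mul1e.
Qed.

Let step_independent n (X : set (measurableTypeR R * measurableTypeR R)) (D : set (measurableTypeR R)) :
  (n < N)%N -> measurable X -> measurable D ->
  (P (S n @^-1` X `&` (fun w => eta n w - xi n w)%R @^-1` D) =
   P (S n @^-1` X) * normal_prob 0 (Num.sqrt (h *+ 2)) D)%E.
Proof.
move=> nN mX mD.
have mF : measurable (S n @^-1` X) by exact: measurable_preimageT.
have := prob_rotated_tail _ T P N h h0 xi eta mxi meta indep n (fun=> setT) (fun=> setT)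
  (S n @^-1` X) D setT nN (fun=> measurableT) (fun=> measurableT) mF _ mD measurableT.
rewrite preimage_setT setIT tail_eventT setIT pT !mule1 setIC => ->.
  by rewrite muleC (prob_diff_increment _ T P N h h0 xi eta mxi meta indep).
by move=> A A' mA mA'; apply: walk_tail => //; exact: ltnW.
Qed.

Let law_step n (f : measurableTypeR R * measurableTypeR R -> measurableTypeR R -> \bar R) :
  (n < N)%N -> measurable_fun setT (fun z => f z.1 z.2) ->
  (forall z y, (0 <= f z y)%E) ->
  (\int[P]_w f (U n w, M n w) (eta n w - xi n w)%R =
  \int[P]_w \int[@lebesgue_measure R]_y (f (U n w, M n w) y * (gauss (h *+ 2) y)%:E))%E.
Proof.
move=> nN mf f0.
have SE w : (U n w, M n w) = S n w by rewrite /U /M; case: (S n w).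
under eq_integral do rewrite SE.
under [RHS]eq_integral do under eq_integral do rewrite SE.
apply: (independent_integral _ _ _ _ _ (S n) (fun w => eta n w - xi n w)) => //.
- exact: (measurable_funB (meta n) (mxi n)).
- by move=> X D mX mD; exact: step_independent.
Qed.

Let lawV (C : set (measurableTypeR R)) : measurable C ->
  P (V N @^-1` C) = normal_prob 0 (Num.sqrt (1 *+ 2)) C.
Proof.
move=> mC; case: hB => B0 _ _ hinc.
(* A grid with the single interval from 0 to 2, as [V N] is [B 2]. *)
have := hinc 1%N (fun i => i%:R * 2) (fun=> C) (mul0r _).
rewrite big_ord_recl big_ord0 mulr1 mul1r mul0r subr0 => H.
rewrite fineK ?fin_num_measure// in H; rewrite -H => [|i _|]; last 2 first.
- by rewrite ltr_pM2r// ltr_nat.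
- by [].
congr (P _); apply/seteqP; split => w /=.
  move=> H' i; rewrite ltnS leqn0 => /eqP ->; rewrite mul0r mul1r B0 subr0.
  by move: H'; rewrite VE natrD mulrDl Nh subrK.
move=> /(_ 0%N isT); rewrite mul0r mul1r B0 subr0 => H'.
by rewrite VE natrD mulrDl Nh subrK.
Qed.

Let indV (X : set (measurableTypeR R * measurableTypeR R)) (C : set (measurableTypeR R)) :
  measurable X -> measurable C ->
  (P ((fun w => (U N w, M N w)) @^-1` X `&` V N @^-1` C) =
   P ((fun w => (U N w, M N w)) @^-1` X) * normal_prob 0 (Num.sqrt (1 *+ 2)) C)%E.
Proof.
move=> mX mC.
have -> : (fun w => (U N w, M N w)) = S N.
  by apply/funext => w; rewrite /U /M; case: (S N w).
have := walk_ind N (leqnn N) (fun=> setT) (fun=> setT) X C (fun=> measurableT) (fun=> measurableT) mX mC.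
by rewrite tail_eventT setIT pT mule1 lawV.
Qed.

Definition slepian_grid : set T :=
  [set w | forall k, (k <= N)%N -> slepian B (k%:R / N%:R) w <= a + b * (k%:R / N%:R)].

Let ME n w r : (M n w <= r) = [forall k : 'I_n.+1, U k w - barrier a b h k <= r].
Proof.
elim: n => [|n IH].
  apply/idP/forallP => [H k|/(_ ord0)].
    by rewrite ord1 /barrier mul0r mulr0 addr0 /U/= sub0r.
  by rewrite /barrier mul0r mulr0 addr0 /U/= sub0r.
rewrite /M /= -/(M n w) ge_max IH.
apply/andP/forallP => [[/forallP H1 H2] k|H].
  have [kn|kn] := ltnP k n.+1; first exact: (H1 (Ordinal kn)).
  have -> : k = n.+1 :> nat by apply/eqP; rewrite eqn_leq kn andbT -ltnS ltn_ord.
  exact: H2.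
split; last exact: (H ord_max).
by apply/forallP => k; exact: (H (widen_ord (leqnSn _) k)).
Qed.

Let grid_eventE : grid_event _ T N U M (V N) = slepian_grid.
Proof.
have B1 w : (V N w - U N w) / 2 = B 1 w.
  by rewrite UE VE Nh; field.
have Sk k w : slepian B (k%:R / N%:R) w = U k w + B 1 w.
  rewrite /slepian UE -/h natrD mulrDl Nh [1 + _]addrC; ring.
have E w k : (U k w - barrier a b h k <= - B 1 w) =
    (slepian B (k%:R / N%:R) w <= a + b * (k%:R / N%:R)).
  rewrite Sk /barrier -/h -[LHS]subr_ge0 -[RHS]subr_ge0; congr (0 <= _); ring.
apply/funext => w; apply/propext; rewrite /grid_event /slepian_grid /= B1.
rewrite -[M N w]opprK subr_le0 lerNr ME; split => [/forallP H k kN|H].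
  by rewrite -E; exact: (H (Ordinal (kN : (k < N.+1)%N))).
by apply/forallP => k; rewrite E; apply: H; rewrite -ltnS.
Qed.

Lemma slepian_grid_lower : b != 0 ->
  ((cumr 1 a * cumr 1 (a + b))%:E <= P slepian_grid + (image_value b a a (a + b))%:E)%E.
Proof.
move=> b0; rewrite -grid_eventE.
exact: (grid_event_lower _ T P N a b h h0 U M _ mU mM (fun=> erefl) (fun=> erefl)
  (fun _ _ => erefl) (fun _ _ => erefl) law_step (V N) (mV N) N0 Nh indV b0).
Qed.

Lemma slepian_grid_upper (e K : R) : b != 0 -> 0 < e -> b / N%:R <= e / 2 ->
  (\int[@lebesgue_measure R]_x ((ind_le0 (x - a) * expR (- (b * (a + e - x))))%:E *
    \int[@lebesgue_measure R]_y ((ind_le0 (y - (a + b)))%:E *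
      (2 * gauss (1 *+ 2) (x + y))%:E)) = K%:E)%E ->
  (P slepian_grid + (image_value b a (a + e) (a + b))%:E <=
  (cumr 1 a * cumr 1 (a + b) + N%:R * gauss (N%:R^-1 *+ 2) (e / 2) * K)%:E)%E.
Proof.
move=> b0 e0 be KE; rewrite -grid_eventE EFinD [(_ * K)%:E]EFinM -KE.
exact: (grid_event_upper _ T P N a b h h0 U M _ mU mM (fun=> erefl) (fun=> erefl)
  (fun _ _ => erefl) (fun _ _ => erefl) law_step (V N) (mV N) N0 Nh indV e b0 e0 be).
Qed.

End SlepianGrid.

(** * Limits in the mesh and in the height of the raised line *)

Section Limits.
Context {R : realType}.
Notation mu := (@lebesgue_measure R).

(** The peak of the density is at most [N], which makes the prefactor [N ^ 2]; a cubic bound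
    [expR (- x) <= 6 / x ^ 3] at [x = r ^ 2 * N / 4] beats it, and [384 = 6 * 4 ^ 3]. *)
Lemma gauss_small (r : R) (N : nat) : 0 < r -> (0 < N)%N ->
  N%:R * gauss (N%:R^-1 *+ 2) r <= 384 / r ^+ 6 / N%:R.
Proof.
move=> r0 N0; have n0 : 0 < N%:R :> R by rewrite ltr0n.
have n1 : 1 <= N%:R :> R by rewrite ler1n.
have v0 : 0 < N%:R^-1 *+ 2 :> R by rewrite pmulrn_lgt0// invr_gt0.
have pi2 : 2 <= pi :> R by exact: pi_ge2.
rewrite gaussE//; set n : R := N%:R in n0 n1 v0 *.
have s0 : (Num.sqrt (n^-1 *+ 2 * pi *+ 2))^-1 <= n.
  rewrite -[leRHS]invrK lef_pV2 ?posrE ?invr_gt0 ?sqrtr_gt0//; last first.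
    by rewrite pmulrn_lgt0// mulr_gt0// pi_gt0.
  have i0 : 0 < n^-1 by rewrite invr_gt0.
  have i1 : n^-1 <= 1 by rewrite invf_le1.
  apply: (@le_trans _ _ (Num.sqrt (n^-1 ^+ 2))).
    by rewrite sqrtr_sqr ger0_norm// ltW.
  rewrite ler_sqrt; last by rewrite mulrn_wge0// mulr_ge0 ?(ltW v0)// (le_trans _ pi2).
  by move: (n^-1) i0 i1 (pi : R) pi2 => i i0 i1 p p2; nra.
pose x := r ^+ 2 * n / 4; have x0 : 0 < x by rewrite divr_gt0// mulr_gt0// exprn_gt0.
have -> : - r ^+ 2 / (n^-1 *+ 2 *+ 2) = - x by rewrite /x; field; rewrite gt_eqF.
have ex : expR (- x) <= 6 / x ^+ 3.
  rewrite expRN -invf_div lef_pV2 ?posrE ?expR_gt0 ?divr_gt0 ?exprn_gt0//.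
  apply: le_trans (expR_ge1Dxn 2 (ltW x0)).
  by rewrite (_ : (3`!)%:R = 6 :> R)// lerDr.
apply: (@le_trans _ _ (n * (n * (6 / x ^+ 3)))).
  by rewrite ler_pM2l//; apply: ler_pM.
by rewrite le_eqVlt; apply/orP; left; apply/eqP; rewrite /x; field; rewrite !gt_eqF.
Qed.

Lemma cumr_lipschitz (v s t : R) : 0 < v -> s <= t ->
  cumr v s <= cumr v t <= cumr v s + gauss v 0 * (t - s).
Proof.
move=> v0 st.
have ind_st u : ind_le0 (u - s) <= ind_le0 (u - t).
  rewrite /ind_le0 !subr_le0 ler_nat; case: (leP u s) => // us.
  by rewrite (le_trans us st).
apply/andP; split; rewrite -lee_fin.
  rewrite -!cumE; apply: ge0_le_integral => //.
  - by move=> u _; rewrite lee_fin mulr_ge0 ?gauss_ge0.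
  - by meas.
  - by meas.
  - by move=> u _; rewrite lee_fin ler_wpM2r ?gauss_ge0.
have Est : (t - s)%:E = mu [set` `]s, t]].
  rewrite lebesgue_measure_itv/= lte_fin; case: ltgtP st => // -> _.
  by rewrite subrr.
have g0 u : gauss v u <= gauss v 0.
  have [u0|/ltW u0] := leP 0 u; first by rewrite le_gauss.
  by rewrite -gauss_opp// le_gauss ?oppr_ge0.
have m1 : measurable_fun setT (\1_[set` `]s, t]] : measurableTypeR R -> R).
  exact: measurable_indic.
rewrite EFinD EFinM -!cumE Est.
have -> : mu [set` `]s, t]] = (\int[mu]_u (\1_[set` `]s, t]] u)%:E)%E.
  by rewrite integral_indic ?setIT.
rewrite -ge0_integralZl//; first last.
- by rewrite lee_fin gauss_ge0.
- exact/measurable_EFinP.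
rewrite -ge0_integralD//; first last.
- by apply: measurable_lame; [meas|exact/measurable_EFinP].
- by move=> u _; rewrite mule_ge0 ?lee_fin ?gauss_ge0.
- by meas.
- by move=> u _; rewrite lee_fin mulr_ge0 ?gauss_ge0.
apply: ge0_le_integral => //.
- by move=> u _; rewrite lee_fin mulr_ge0 ?gauss_ge0.
- by meas.
- apply: measurable_lamade; first by meas.
  by apply: measurable_lame; [meas|exact/measurable_EFinP].
move=> u _; rewrite -EFinM -EFinD lee_fin indicE mem_setE in_itv/= /ind_le0 !subr_le0.
have := g0 u; have := gauss_ge0 v u; have := gauss_ge0 v (0 : R).
case: (leP u s) => us; case: (leP u t) => ut /=; rewrite ?mul1r ?mul0r ?mulr0 ?mulr1; lra.
Qed.

Lemma continuous_cumr (v : R) : 0 < v -> continuous (cumr v).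
Proof.
move=> v0 t; apply/cvgrPdist_le => e e0.
have g0 : 0 <= gauss v 0 :> R by exact: gauss_ge0.
near=> x.
have xt : `|t - x| * (gauss v 0 + 1) <= e.
  rewrite -ler_pdivlMr ?ltr_wpDl//; near: x.
  apply: cvgr_dist_le; first exact: cvg_id.
  by rewrite divr_gt0// ltr_wpDl.
apply: le_trans xt; have [tx|/ltW xt] := leP t x.
  have /andP[h1 h2] := cumr_lipschitz v t x v0 tx.
  rewrite [leLHS]distrC ger0_norm ?subr_ge0// distrC ger0_norm ?subr_ge0//; nra.
have /andP[h1 h2] := cumr_lipschitz v x t v0 xt.
rewrite ger0_norm ?subr_ge0// ger0_norm ?subr_ge0//; nra.
Unshelve. all: by end_near. Qed.

Lemma continuous_gauss (v : R) : 0 < v -> continuous (gauss v).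
Proof. by move=> v0; apply: continuous_normal_pdf; rewrite gt_eqF// sqrtr_gt0. Qed.

Lemma cvg_image_value (a b c : R) :
  image_value b a (a + e) c @[e --> 0^'+] --> image_value b a a c.
Proof.
rewrite -[X in _ --> image_value b a X c]addr0.
have e0 : (e @[e --> (0:R)^'+]) --> (0:R) by apply: cvg_at_right_filter; exact: cvg_id.
have ae : (a + e @[e --> (0:R)^'+]) --> a + 0 by apply: cvgD => //; exact: cvg_cst.
have ce : (c - (a + e) @[e --> (0:R)^'+]) --> c - (a + 0) by apply: cvgB => //; exact: cvg_cst.
have ace : (a + (c - (a + e)) @[e --> (0:R)^'+]) --> a + (c - (a + 0)) by apply: cvgD => //; exact: cvg_cst.
have comp (f g : R -> R) l : continuous f -> (g e @[e --> (0:R)^'+]) --> l ->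
    (f (g e) @[e --> (0:R)^'+]) --> f l.
  by move=> cf gl; apply: continuous_cvg => //; exact: cf.
have cE := @continuous_expR R.
have cC := @continuous_cumr 1 ltr01.
apply: cvgM; first apply: cvgM.
- by apply: (comp (gauss 1)) => //; exact: continuous_gauss.
- apply: (comp expR) => //; apply: cvgN; apply: cvgM => //; exact: cvg_cst.
apply: cvgM; last exact: cvg_cst.
apply: cvgB; apply: cvgM.
- exact: cvg_cst.
- exact: (comp (cumr 1)).
- apply: (comp expR) => //; apply: cvgB; first exact: cvg_cst.
  by apply: cvgM => //; exact: cvg_cst.
- apply: (comp (cumr 1)) => //; apply: cvgB => //; exact: cvg_cst.
Qed.

End Limits.

(** * From dyadic grids to the whole interval *)

Section SlepianLimit.
Context {R : realType} d (T : measurableType d) (P : probability T R).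
Variables (B : R -> T -> R) (hB : is_std_brownian P B) (a b : R).

Lemma measurable_slepian_grid (N : nat) : measurable (slepian_grid _ T B N a b).
Proof.
have -> : slepian_grid _ T B N a b = \bigcap_(k in [set k | (k <= N)%N])
    [set w | slepian B (k%:R / N%:R) w <= a + b * (k%:R / N%:R)] by [].
apply: bigcap_measurableType => k _.
case: hB => _ _ mB _.
have mS : measurable_fun setT (fun w => slepian B (k%:R / N%:R) w : measurableTypeR R).
  by apply: (@measurable_funB _ _ _ _ (B _) (B _)); apply: mB; rewrite ?addr_ge0.
have := mS measurableT [set` `]-oo, a + b * (k%:R / N%:R)]] (measurable_itv _).
by rewrite setTI; congr measurable; apply/seteqP; split => w /=; rewrite in_itv.
Qed.

(** Makes the dyadic events decrease, as continuity of [P] from above requires. *)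
Lemma slepian_grid_mul (N m : nat) : (0 < m)%N ->
  slepian_grid _ T B (N * m) a b `<=` slepian_grid _ T B N a b.
Proof.
move=> m0 w H k kN; have := H (k * m)%N; rewrite leq_mul2r kN orbT => /(_ isT).
by rewrite !natrM -mulf_div divff ?mulr1// pnatr_eq0 -lt0n.
Qed.

(** Paths are continuous only within the half-line, so the approximating times must be
    nonnegative. *)
Let slepian_cvg w (t : R) (u : nat -> R) : 0 <= t -> (forall n, 0 <= u n) ->
  u n @[n --> \oo] --> t -> slepian B (u n) w @[n --> \oo] --> slepian B t w.
Proof.
move=> t0 u0 ut; case: hB => _ cB _ _.
have Bcvg (x : R) (v : nat -> R) : 0 <= x -> (forall n, 0 <= v n) ->
    v n @[n --> \oo] --> x -> B (v n) w @[n --> \oo] --> B x w.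
  move=> x0 v0 vx.
  have /subspace_continuousP H := cB w.
  have xA : [set` `[0, +oo[] x by rewrite /= in_itv/= x0.
  apply: cvg_comp (H x xA) => A /= hA.
  have vA n : [set` `[0, +oo[] (v n) by rewrite /= in_itv/= v0.
  have Hn : \forall n \near \oo, [set` `[0, +oo[] (v n) -> A (v n) := vx _ hA.
  by apply: filterS Hn => n; exact.
apply: cvgB; apply: Bcvg => //; first by rewrite addr_ge0.
  by move=> n; rewrite addr_ge0.
by apply: cvgD => //; exact: cvg_cst.
Qed.

Lemma slepian_eventE :
  [set w | forall t : R, 0 <= t <= 1 -> slepian B t w <= a + b * t] =
  \bigcap_n slepian_grid _ T B (2 ^ n) a b.
Proof.
apply/seteqP; split => w /= H.
  move=> n _ k kn; apply: H; rewrite divr_ge0//=.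
  by rewrite ler_pdivrMr ?ltr0n ?expn_gt0// mul1r ler_nat.
move=> t /andP[t0 t1].
(* Rounds [t] down to the dyadic grid; the weak inequality then passes to the limit. *)
pose k n := Num.truncn (t * (2 ^ n)%:R); pose u n : R := (k n)%:R / (2 ^ n)%:R.
have p0 n : 0 < (2 ^ n)%:R :> R by rewrite ltr0n expn_gt0.
have u0 n : 0 <= u n by rewrite divr_ge0.
have kt n : (k n)%:R <= t * (2 ^ n)%:R < (k n).+1%:R.
  by apply: truncn_itv; rewrite mulr_ge0// ltW.
have kn n : (k n <= 2 ^ n)%N.
  rewrite -(ler_nat R); have /andP[+ _] := kt n => /le_trans; apply.
  by rewrite ler_piMl// ltW.
have ut : u n @[n --> \oo] --> t.
  apply/cvgrPdist_le => e e0; near=> n.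
  have /andP[h1 h2] := kt n.
  have un : u n <= t by rewrite ler_pdivrMr.
  rewrite ger0_norm ?subr_ge0//.
  have tn : t - u n <= (2 ^ n)%:R^-1.
    rewrite -(ler_pM2r (p0 n)) mulVf ?gt_eqF// mulrBl /u divfK ?gt_eqF//.
    by move: h2; rewrite -natr1; lra.
  apply: le_trans tn _; rewrite -[leRHS]invrK lef_pV2 ?posrE ?invr_gt0//.
  have en : e^-1 <= n%:R by near: n; exact: nbhs_infty_ger.
  by apply: le_trans en _; rewrite ler_nat ltnW// ltn_expl.
have lhs := slepian_cvg w t u t0 u0 ut.
have rhs : a + b * u n @[n --> \oo] --> a + b * t.
  by apply: cvgD; [exact: cvg_cst|apply: cvgM => //; exact: cvg_cst].
apply: (ler_cvg_to lhs rhs); apply: nearW => n; exact: H.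
Unshelve. all: by end_near. Qed.

Let grid n := slepian_grid _ T B (2 ^ n) a b.

Let N0 n : (0 < 2 ^ n)%N. Proof. by rewrite expn_gt0. Qed.

Let mgrid n : measurable (grid n). Proof. exact: measurable_slepian_grid. Qed.

Let mcap : measurable (\bigcap_n grid n).
Proof. exact: bigcapT_measurable. Qed.

(** The bound on each grid is free of [n], so it survives the decreasing limit. *)
Lemma slepian_lower : b != 0 ->
  ((cumr 1 a * cumr 1 (a + b) - image_value b a a (a + b))%:E <=
   P (\bigcap_n grid n))%E.
Proof.
move=> b0.
have cvgP : (P \o grid) n @[n --> \oo] --> P (\bigcap_n grid n).
  apply: nonincreasing_cvg_mu => //.
    by rewrite (le_lt_trans (probability_le1 P (mgrid 0)))// ltry.
  apply/nonincreasing_seqP => n; apply/subsetPset.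
  by rewrite /grid expnSr; exact: slepian_grid_mul.
apply: (cvge_to_ge cvgP); apply: nearW => n /=.
rewrite EFinB leeBlDr//.
exact: (slepian_grid_lower _ T P B hB _ (N0 n) a b b0).
Qed.

(** No limit in the mesh is taken: the intersection lies in each grid event, so for given [e] and
    [r] a single fine grid suffices. Then [r] is removed, and [e] tends to 0 by continuity of
    [image_value]. *)
Lemma slepian_upper : b != 0 ->
  (P (\bigcap_n grid n) <=
   (cumr 1 a * cumr 1 (a + b) - image_value b a a (a + b))%:E)%E.
Proof.
move=> b0.
have Pfin : P (\bigcap_n grid n) \is a fin_num by exact: fin_num_measure.
rewrite -(fineK Pfin) lee_fin; set p := fine _.
suff H e : 0 < e -> image_value b a (a + e) (a + b) <= cumr 1 a * cumr 1 (a + b) - p.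
  rewrite lerBrDr -lerBrDl; apply: (cvgr_to_le (cvg_image_value a b (a + b))).
  by near=> e; apply: H; near: e; exact: nbhs_right_gt.
move=> e0.
have [K KE] := integral_image_mass b a (a + e) (a + b) b0.
apply/ler_addgt0Pr => r r0.
have e20 : 0 < e / 2 by rewrite divr_gt0.
pose C := 384 / (e / 2) ^+ 6 * `|K|.
have C0 : 0 <= C / r.
  apply: divr_ge0; last exact: ltW.
  apply: mulr_ge0; last exact: normr_ge0.
  by apply: divr_ge0; [exact: ler0n|apply: exprn_ge0; exact: ltW].
have B0 : 0 <= `|b| / (e / 2) by rewrite divr_ge0// ltW.
(* As [2 ^ m >= m], the first summand brings the jump error below [r], and the second gives
   [b / N <= e / 2]. *)
pose m := (Num.truncn (C / r + `|b| / (e / 2))).+1.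
have mlt : C / r + `|b| / (e / 2) < m%:R.
  have /andP[_] : (Num.truncn (C / r + `|b| / (e / 2)))%:R <= C / r + `|b| / (e / 2) < m%:R.
    by apply: truncn_itv; exact: addr_ge0.
  by [].
set N := (2 ^ m)%N.
have n0 : 0 < N%:R :> R.
  by rewrite ltr0n; exact: N0.
have mN : m%:R <= N%:R :> R by rewrite ler_nat ltnW// ltn_expl.
have bN : b / N%:R <= e / 2.
  rewrite ler_pdivrMr// (le_trans (ler_norm b))// mulrC -ler_pdivrMr//.
  by apply: le_trans mN; lra.
have CN : C / N%:R <= r.
  rewrite ler_pdivrMr// mulrC -ler_pdivrMr//.
  by apply: le_trans mN; lra.
have KN : N%:R * gauss (N%:R^-1 *+ 2) (e / 2) * K <= r.
  apply: le_trans CN; rewrite /C [leRHS]mulrAC.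
  apply: (@le_trans _ _ (N%:R * gauss (N%:R^-1 *+ 2) (e / 2) * `|K|)).
    by rewrite ler_wpM2l ?ler_norm// mulr_ge0// gauss_ge0.
  by rewrite ler_wpM2r//; exact: (gauss_small _ _ e20 (N0 m)).
have := slepian_grid_upper _ T P B hB N (N0 m) a b e K b0 e0 bN KE.
have : (P (\bigcap_n grid n) <= P (slepian_grid _ T B N a b))%E.
  apply: le_measure; rewrite ?inE//; first exact: (mgrid m).
  by move=> w; apply.
rewrite -(fineK Pfin) -/p.
have Qfin : P (slepian_grid _ T B N a b) \is a fin_num.
  by apply: fin_num_measure; exact: (mgrid m).
rewrite -(fineK Qfin) -EFinD !lee_fin => h1 h2.
move: h1 h2 KN; set G := _ * gauss _ _ * K; set F := cumr 1 a * _; lra.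
Unshelve. all: by end_near. Qed.

End SlepianLimit.

Theorem theorem3p4 (R : realType) (d : measure_display) (T : measurableType d)
    (P : probability T R) (B : R -> T -> R) (hB : is_std_brownian P B)
    (a b : R) (hb : b != 0) :
  P [set w | forall t : R, 0 <= t <= 1 -> slepian B t w <= a + b * t]
  = (std_Phi (a + b) * std_Phi a - b^-1 * std_phi a * std_Phi (a + b)
     + Num.sqrt (pi *+ 2) / b * std_phi a * std_phi b * std_Phi a
       * expR (- (a * b)))%:E.
Proof.
rewrite (slepian_eventE _ _ P _ hB).
transitivity ((cumr 1 a * cumr 1 (a + b) - image_value b a a (a + b))%:E).
  by apply/eqP; rewrite eq_le (slepian_upper _ _ P _ hB)// (slepian_lower _ _ P _ hB).
rewrite /image_value gauss1.
have -> : a + (a + b - a) = a + b by ring.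
have -> : a + b - 1 * b = a by ring.
rewrite !cumr_Phi; congr EFin.
have s0 : Num.sqrt (pi *+ 2) != 0 :> R by rewrite gt_eqF// sqrtr_gt0 pmulrn_lgt0// pi_gt0.
have -> : Num.sqrt (pi *+ 2) / b * std_phi a * std_phi b * std_Phi a * expR (- (a * b)) =
    expR (- b ^+ 2 / 2) * expR (- (a * b)) * std_phi a * std_Phi a / b.
  (* [Num.sqrt (pi *+ 2)] cancels the normalisation of [std_phi b], leaving the factor
     [expR (- b ^+ 2 / 2)] that the tilting in [image_value] produces. *)
  by rewrite [std_phi b]/std_phi; field; rewrite s0 hb.
rewrite -expRD.
have e1 : expR (- (b * a)) * expR (b * a) = 1 by rewrite -expRD addNr expR0.
have -> : - b ^+ 2 / 2 - a * b = - (b * a) + (1 * b ^+ 2 / 2 - b * (a + b - a)) by field.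
rewrite [X in _ = _ + X * _ * _ / _]expRD.
move: e1; move: (expR _) (expR _) (expR _) (std_phi a) (std_Phi _) (std_Phi _) => x y z f F G zy.
transitivity (G * F - z * y * f * F / b + z * x * f * G / b); first by ring.
by rewrite zy mul1r; ring.
Qed.
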